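(* For any integer $n \ge 3$, let $E(n)$ be the number of distinct values of $e$ such that $n$ does not divide $2e$ and $\rho(\mathcal{G}_{n,e}) = \rho(\mathcal{M}_{n,e})$. Then the following hold: 1. $E(n) \ge \left\lfloor \frac{3n-5}{2} \right\rfloor$. 2. The lower bound in part 1 is tight (holds with equality) if and only if $n = p$ or $n = 2p$ for some prime number $p$. 3. For an infinite family of highly composite, square-free integers $n$, $E(n) = \Omega(n \log n)$.
   Context: Here $e$ ranges over non-negative integers. $\mathcal{M}_{n,e}$ is the set of symmetric $n\times n$ real matrices with non-negative entries (diagonal entries may be non-zero) such that all row sums are integers and the sum of all entries is $2e$; $\rho(\mathcal{M}_{n,e})$ is the minimum of the spectral radius $\rho(M)$ over $M$ in this (compact) set. $\mathcal{G}_{n,e}$ is the family of simple undirected graphs (not necessarily connected) with $n$ vertices and $e$ edges; $\rho(\mathcal{G}_{n,e})$ is the minimum over $G \in \mathcal{G}_{n,e}$ of the spectral radius of the adjacency matrix of $G$. If $\mathcal{G}_{n,e}$ is empty (i.e. $e > \binom{n}{2}$), the equality $\rho(\mathcal{G}_{n,e}) = \rho(\mathcal{M}_{n,e})$ is regarded as false. In part 3, $E(n)=\Omega(n\log n)$ means that there is a constant $c>0$ with $E(n)\ge c\,n\log n$ for all sufficiently large $n$ in the family; ''highly composite'' is used as a descriptive term for integers with very many divisors relative to their size. *)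

(* Defs.v *)
From HB Require Import structures.
From mathcomp Require Import all_boot all_order all_algebra.
From mathcomp Require Import finmap.
From mathcomp Require Import all_classical all_reals all_analysis.
From mathcomp Require Import complex.

Set Implicit Arguments.
Unset Strict Implicit.
Unset Printing Implicit Defensive.

Import Order.TTheory GRing.Theory Num.Theory.
Local Open Scope classical_set_scope.
Local Open Scope ring_scope.

(* The eigenvalues are the complex ones, i.e. those of A seen as a matrix over
   R[i]; there are finitely many of them, so for n > 0 the supremum is a
   maximum. *)
Definition spectral_radius (R : realType) (n : nat) (A : 'M[R]_n) : R :=
  sup [set ComplexField.Normc.normc z
      | z in [set z : R[i] | eigenvalue (map_mx (real_complex R) A) z]].

Definition integral_row_matrices (R : realType) (n e : nat) : set 'M[R]_n :=
  [set M | [/\ M^T = M,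
               forall i j, 0 <= M i j,
               forall i, \sum_j M i j \is a Num.int
             & \sum_i \sum_j M i j = (2 * e)%:R]].

Definition simple_graph (n : nat) (g : rel 'I_n) : Prop :=
  symmetric g /\ irreflexive g.

Definition edges (n : nat) (g : rel 'I_n) : {set {set 'I_n}} :=
  [set [set p.1; p.2]%SET | p : 'I_n * 'I_n & g p.1 p.2]%SET.

Definition adjacency (R : realType) (n : nat) (g : rel 'I_n) : 'M[R]_n :=
  \matrix_(i, j) (g i j)%:R.

Definition graph_matrices (R : realType) (n e : nat) : set 'M[R]_n :=
  [set M | exists g : rel 'I_n,
             [/\ simple_graph g, #|edges g| = e & M = adjacency R g]].

Arguments integral_row_matrices : clear implicits.
Arguments graph_matrices : clear implicits.

Definition is_min_spectral_radius (R : realType) (n : nat) (S : set 'M[R]_n)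
    (r : R) : Prop :=
  [set spectral_radius M | M in S] r /\
  lbound [set spectral_radius M | M in S] r.

(* The two minima are equal. This is false when there is no graph with n
   vertices and e edges, since then the graph family has no minimum. *)
Definition min_spectral_radii_agree (R : realType) (n e : nat) : Prop :=
  exists r : R, is_min_spectral_radius (graph_matrices R n e) r /\
                is_min_spectral_radius (integral_row_matrices R n e) r.

Definition agreeing_edge_counts (R : realType) (n : nat) : set nat :=
  [set e | ~~ (n %| 2 * e)%N /\ min_spectral_radii_agree R n e].

(* fset_set sends infinite sets to the empty one, but agreeing_edge_counts R n
   is contained in {0, ..., 'C(n, 2)}. *)
Definition E (R : realType) (n : nat) : nat :=
  #|` fset_set (agreeing_edge_counts R n)|%fset.

Definition square_free (n : nat) : Prop :=
  forall d : nat, (d ^ 2 %| n)%N -> d = 1%N.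

(* "Highly composite" in the descriptive sense: along S, the number of divisors
   of n eventually exceeds every fixed power of log n (log n being its average
   order over all integers). Ramanujan's record-setting sense cannot be meant:
   the only square-free integers with that property are 1, 2 and 6. *)
Definition highly_composite_family (R : realType) (S : set nat) : Prop :=
  forall k : nat, \forall n \near \oo,
    S n -> ln (n%:R : R) ^+ k <= (size (divisors n))%:R.

(* Main.v *)
Require Import Defs.
From mathcomp Require Import all_boot all_order all_algebra.
From mathcomp Require Import finmap.
From mathcomp Require Import all_classical all_reals all_analysis.
From mathcomp Require Import complex.
From mathcomp Require Import zify ring lra.

Set Implicit Arguments.
Unset Strict Implicit.
Unset Printing Implicit Defensive.

Import Order.TTheory GRing.Theory Num.Theory.
Local Open Scope classical_set_scope.
Local Open Scope ring_scope.

(** Write 2e = nq + r with 0 < r < n.  A matrix with integral row sums has the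
    smallest spectral radius when its row sums are as equal as possible: r rows
    (the upper level) of sum q+1 and n-r rows (the lower level) of sum q.  Among
    these matrices the radius drops as the weight joining the two levels grows,
    and the only obstruction is that the entries inside one of the levels
    run out.  So at the optimum one level is independent, and the optimal value
    rho is the Perron root of a 2 x 2 quotient matrix.  The upper level is the
    independent one when r(2q+1) <= qn, the lower level otherwise.

    The lower bound is a Rayleigh quotient, taken at the vector that equals the
    Perron entry u on the rows of sum > q and v on the others.  The quadratic
    form minus rho times the squared norm turns out to be a combination, with
    positive coefficients, of two nonnegative quantities: the deviation of the row
    sums from q and q+1, and the weight inside the level that should be
    independent.  Hence rho is a lower bound, and a matrix of radius rho has the
    optimal row sums, an independent level and the test vector as an eigenvector
    ([upper_level_independent], [lower_level_independent]).  The block-constant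
    matrix with these parameters attains rho, so the two minima agree exactly
    when a simple graph attains rho.  For a graph, the eigenvector equation says
    that the number of neighbours in the upper level is constant on the level that
    is not independent; it must be an integer, which is a divisibility condition
    on n, q and r.  Conversely, biregular bipartite graphs and circulant graphs
    realise every admissible choice ([agree_attainable]).

    Now count.  With g = gcd(n, r), r = g r' and n - r = g s', the condition says
    that q = 0, or that r' < s' and q + 1 = k s', or that r' >= s' and q = k r',
    with 1 <= k <= g in both cases (and n - r > 1 in the last one); moreover
    nq + r must be even.  For n = 2N this gives the sum of 1 + 2 gcd(N, s) over
    0 < s < N.  For odd n and 0 < r <= n - 2, the value k = 1 is always admissible
    and k = 3 is admissible as soon as g >= 3.  In both cases the bound of part 1
    appears when all the gcds are replaced by 1, so it is attained iff n (for n
    odd) or n/2 (for n even) is prime ([total_count_bound]).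

    For part 3, the sum of gcd(N, s) over s < N is multiplied by 2p - 1 when N is
    multiplied by a new prime p.  For an even product n of k distinct primes this
    makes E(n) at least of the order of n (3/2)^k.  For the product of all the primes up
    to a bound, log n is at most 2 k^2, because every integer up to M^2 is a square
    times a product of distinct primes, whence there are at least log_2 M primes
    below M^2. *)

(** * Spectral radius and Rayleigh quotients *)

Section Spectral.
Variable R : realType.
Implicit Types n : nat.
Local Notation normc := ComplexField.Normc.normc.
Local Notation toC := (real_complex R).

Lemma normcE (z : R[i]) : `|z| = (normc z)%:C%C.
Proof. by []. Qed.

(** Collatz-Wielandt: compare the moduli of the entries of an eigenvector with
    x at an index where their quotient is largest. *)
Lemma normc_eigenvalue_le n (M : 'M[R]_n) (x : 'I_n -> R) (rho : R) z :
  (forall i j, 0 <= M i j) -> (forall i, 0 < x i) ->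
  (forall j, \sum_i x i * M i j <= rho * x j) ->
  eigenvalue (map_mx toC M) z -> normc z <= rho.
Proof.
move=> M0 x0 Mx /eigenvalueP [v vM v0].
have [j0 vj0] : exists j, v 0 j != 0.
  apply/existsP; rewrite -[[exists _, _]]negbK negb_exists.
  apply: contraNN v0 => /forallP v0; apply/eqP/rowP => j; rewrite mxE.
  by apply/eqP; have := v0 j; rewrite negbK.
pose y j := normc (v 0 j).
have yE j : (y j)%:C%C = `|v 0 j| by rewrite normcE.
have y0 j : 0 <= y j by rewrite -ler0c yE.
have ypos : 0 < y j0 by rewrite -ltcR yE normr_gt0.
case: (@Order.TotalTheory.arg_maxP _ _ _ j0 xpredT (fun j => y j / x j) isT) => j _ jmax.
set m := y j / x j in jmax.
have m0 : 0 < m.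
  by apply: lt_le_trans (jmax j0 isT); rewrite divr_gt0.
have yj : y j = m * x j by rewrite /m divfK // gt_eqF.
have yle i : y i <= m * x i by rewrite -ler_pdivrMr //; apply: jmax.
have step : normc z * y j <= \sum_i y i * M i j.
  rewrite -lecR rmorphM /= -normcE yE -normrM.
  move/rowP/(_ j): vM; rewrite !mxE => <-.
  rewrite rmorph_sum /=; apply: le_trans (ler_norm_sum _ _ _) _.
  apply: ler_sum => i _; rewrite mxE normrM rmorphM /= yE.
  by rewrite (@ger0_norm _ (M i j)%:C%C) ?ler0c.
have : normc z * y j <= m * (rho * x j).
  apply: le_trans step _.
  apply: (@le_trans _ _ (\sum_i m * (x i * M i j))).
    by apply: ler_sum => i _; rewrite mulrA ler_wpM2r.
  by rewrite -mulr_sumr ler_pM2l.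
by rewrite yj mulrCA ler_pM2l // ler_pM2r.
Qed.

Lemma spectral_radius_has_sup n (M : 'M[R]_n) : (0 < n)%N ->
  (forall i j, 0 <= M i j) ->
  has_sup [set normc z | z in [set z : R[i] | eigenvalue (map_mx toC M) z]].
Proof.
move=> n0 M0; split.
  have [z ez] := eigenvalue_closed (map_mx toC M) n0.
  by exists (normc z), z.
exists (\sum_i \sum_j M i j) => _ [z /= ez <-].
apply: (@normc_eigenvalue_le _ M (fun=> 1)) ez => // j.
rewrite mulr1; apply: ler_sum => i _; rewrite mul1r (bigD1 j) //= lerDl.
exact: sumr_ge0.
Qed.

Lemma spectral_radius_le n (M : 'M[R]_n) (x : 'I_n -> R) (rho : R) : (0 < n)%N ->
  (forall i j, 0 <= M i j) -> (forall i, 0 < x i) ->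
  (forall j, \sum_i x i * M i j <= rho * x j) ->
  spectral_radius M <= rho.
Proof.
move=> n0 M0 x0 Mx; apply: ge_sup.
  by have [] := spectral_radius_has_sup n0 M0.
by move=> _ [z /= ez <-]; apply: normc_eigenvalue_le ez.
Qed.

Lemma normc_eigenvalue_le_radius n (M : 'M[R]_n) z : (0 < n)%N ->
  (forall i j, 0 <= M i j) -> eigenvalue (map_mx toC M) z ->
  normc z <= spectral_radius M.
Proof.
move=> n0 M0 ez; apply: ub_le_sup; last by exists z.
by have [] := spectral_radius_has_sup n0 M0.
Qed.

Local Open Scope sesquilinear_scope.

(** M is unitarily diagonalisable over R[i].  In an eigenbasis the form is the
    sum of the eigenvalues weighted by the squared moduli of the coordinates, and
    each eigenvalue is real and at most the spectral radius. *)
Lemma rayleigh_le_mx n (M : 'M[R]_n) (x : 'rV[R]_n) : (0 < n)%N ->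
  (forall i j, 0 <= M i j) -> M^T = M ->
  (x *m M *m x^T) 0 0 <= spectral_radius M * (x *m x^T) 0 0.
Proof.
move=> n0 M0 MT.
pose A := map_mx toC M; pose X := map_mx toC x.
have realA : A \is a realmx.
  by apply/mxOverP => i j; rewrite mxE; apply/complex_realP; exists (M i j).
have symA : A \is symmetricmx.
  by apply/is_hermitianmxP; rewrite expr0 scale1r map_mx_id // /A map_trmx MT.
have hermA := realsym_hermsym symA realA.
have /orthomx_spectralP := hermitian_normalmx hermA.
set P := spectralmx A; set sp := spectral_diag A => AE.
have PU : P \is unitarymx := spectral_unitarymx A.
have spreal := hermitian_spectral_diag_real hermA.
have Punit := unitarymx_unit PU.
have speig k : eigenvalue A (sp 0 k).
  apply/eigenvalueP; exists (row k P).
    rewrite {1}AE -row_mul !mulmxA mulmxV // mul1mx.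
    by apply/rowP => j; rewrite !mxE (bigD1 k) //= big1 ?addr0 ?mxE ?eqxx ?mulr1n // => i ik;
       rewrite mxE eq_sym (negPf ik) mulr0n mul0r.
  apply/eqP => /(congr1 (mulmx^~ (invmx P))); rewrite mul0mx -row_mul mulmxV //.
  by move/rowP/(_ k); rewrite !mxE eqxx /=; apply/eqP; rewrite oner_eq0.
have sple k : sp 0 k <= (spectral_radius M)%:C%C.
  have spr : sp 0 k \is Num.real by apply: (mxOverP spreal).
  apply: le_trans (real_ler_norm spr) _.
  by rewrite normcE lecR; apply: normc_eigenvalue_le_radius.
have XT : X ^t* = X^T.
  apply/matrixP => i j; rewrite !mxE; apply/CrealP/complex_realP; eexists; reflexivity.
pose W := X *m P ^t*.
have WT : W ^t* = P *m X ^T.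
  by rewrite /W trmx_mul map_mxM trmxCK XT.
have E1 : X *m A *m X^T = W *m diag_mx sp *m W ^t*.
  by rewrite WT /W {1}AE invmx_unitary // !mulmxA.
have E2 : X *m X^T = W *m W ^t*.
  by rewrite WT /W -!mulmxA -(invmx_unitary PU) mulKmx.
rewrite -lecR rmorphM /=.
have -> : ((x *m M *m x^T) 0 0)%:C%C = (X *m A *m X^T) 0 0.
  by rewrite /X /A map_trmx -2!map_mxM [RHS]mxE.
have -> : ((x *m x^T) 0 0)%:C%C = (X *m X^T) 0 0.
  by rewrite /X map_trmx -map_mxM [RHS]mxE.
rewrite E1 E2 !mxE mulr_sumr; apply: ler_sum => k _.
rewrite mul_mx_diag !mxE mulrAC mulrC.
by apply: ler_wpM2r => //; rewrite -normCK exprn_ge0.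
Qed.

(** The form of Q = rho - M is positive semidefinite.  Where it vanishes it has a
    minimum, so its derivative in the direction y = x Q, which is twice the
    squared norm of y, vanishes as well. *)
Lemma rayleigh_eq_mx n (M : 'M[R]_n) (x : 'rV[R]_n) : (0 < n)%N ->
  (forall i j, 0 <= M i j) -> M^T = M ->
  (x *m M *m x^T) 0 0 = spectral_radius M * (x *m x^T) 0 0 ->
  x *m M = spectral_radius M *: x.
Proof.
move=> n0 M0 MT xM; set rho := spectral_radius M in xM *.
have [Q QE] : exists Q, Q = rho%:M - M by eexists.
have QT : Q^T = Q by rewrite QE linearB /= tr_scalar_mx MT.
have formQ (y : 'rV[R]_n) : (y *m Q *m y^T) 0 0 =
    rho * (y *m y^T) 0 0 - (y *m M *m y^T) 0 0.
  rewrite QE mulmxBr mulmxBl mul_mx_scalar -scalemxAl.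
  by move: (y *m M *m y^T) (y *m y^T) => U V; rewrite !mxE.
have psd (y : 'rV[R]_n) : 0 <= (y *m Q *m y^T) 0 0.
  by rewrite formQ subr_ge0 rayleigh_le_mx.
have xQ0 : (x *m Q *m x^T) 0 0 = 0 by rewrite formQ xM subrr.
pose y := x *m Q.
pose c := (y *m y^T) 0 0; pose D := (y *m Q *m y^T) 0 0.
have D0 : 0 <= D := psd y.
have expand t : ((x + t *: y) *m Q *m (x + t *: y)^T) 0 0 = 2 * t * c + t ^+ 2 * D.
  have -> : (x + t *: y)^T = x^T + t *: y^T by apply/matrixP => i j; rewrite !mxE.
  rewrite !mulmxDl !mulmxDr -!scalemxAl -!scalemxAr.
  have -> : y *m Q *m x^T = y *m y^T.
    by rewrite -mulmxA; congr (_ *m _); rewrite /y trmx_mul QT.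
  have : (y *m x^T) 0 0 = 0 by [].
  rewrite -/y /c /D; move: (y *m x^T) (y *m y^T) (y *m Q *m y^T) => U V W U0.
  by rewrite !mxE U0; ring.
have cS : c = \sum_i y 0 i ^+ 2.
  by rewrite /c [LHS]mxE; apply: eq_bigr => i _; rewrite [y^T _ _]mxE expr2.
have c0 : 0 <= c by rewrite cS; apply: sumr_ge0 => i _; apply: sqr_ge0.
have cE : c = 0.
  apply/eqP; rewrite eq_le c0 andbT leNgt; apply/negP => cpos.
  (* The minimum along y is at t = - c / D; the denominator D + 1 also covers D = 0. *)
  have := psd (x + (- c / (D + 1)) *: y); rewrite expand.
  have D1 : 0 < D + 1 by rewrite ltr_wpDl.
  have -> : 2 * (- c / (D + 1)) * c + (- c / (D + 1)) ^+ 2 * D =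
     - (c ^+ 2 * (D + 2) / (D + 1) ^+ 2).
    by field; rewrite gt_eqF.
  rewrite oppr_ge0 leNgt divr_gt0 // ?exprn_gt0 // mulr_gt0 ?exprn_gt0 //.
  by rewrite ltr_wpDl.
have y0 : y = 0.
  apply/rowP => j; rewrite [RHS]mxE; apply/eqP; rewrite -sqrf_eq0 eq_le sqr_ge0 andbT.
  rewrite -cE cS (bigD1 j) //= lerDl.
  by apply: sumr_ge0 => i _; apply: sqr_ge0.
move: y0; rewrite /y QE mulmxBr mul_mx_scalar => /eqP; rewrite subr_eq0.
by move=> /eqP <-.
Qed.

Lemma form_sumE n (M : 'M[R]_n) (x : 'I_n -> R) :
  ((\row_i x i) *m M *m (\row_i x i)^T) 0 0 = \sum_i \sum_j x i * M i j * x j.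
Proof.
rewrite mxE exchange_big /=; apply: eq_bigr => j _.
by rewrite !mxE mulr_suml; apply: eq_bigr => i _; rewrite !mxE.
Qed.

Lemma norm_sumE n (x : 'I_n -> R) :
  ((\row_i x i) *m (\row_i x i)^T) 0 0 = \sum_i x i ^+ 2.
Proof. by rewrite mxE; apply: eq_bigr => i _; rewrite !mxE expr2. Qed.

Lemma rayleigh_le n (M : 'M[R]_n) (x : 'I_n -> R) : (0 < n)%N ->
  (forall i j, 0 <= M i j) -> M^T = M ->
  \sum_i \sum_j x i * M i j * x j <= spectral_radius M * \sum_i x i ^+ 2.
Proof. by move=> n0 M0 MT; rewrite -form_sumE -norm_sumE rayleigh_le_mx. Qed.

Lemma rayleigh_eq n (M : 'M[R]_n) (x : 'I_n -> R) : (0 < n)%N ->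
  (forall i j, 0 <= M i j) -> M^T = M ->
  \sum_i \sum_j x i * M i j * x j = spectral_radius M * \sum_i x i ^+ 2 ->
  forall i, \sum_j M i j * x j = spectral_radius M * x i.
Proof.
move=> n0 M0 MT; rewrite -form_sumE -norm_sumE => /rayleigh_eq_mx E i.
have /rowP/(_ i) := E n0 M0 MT; rewrite !mxE => <-.
by apply: eq_bigr => j _; rewrite -{1}MT !mxE mulrC.
Qed.

End Spectral.

(** * The lower bound for prescribed row sums *)

Section TwoLevel.
Variable R : realType.

Lemma rayleigh_lower n (M : 'M[R]_n) (x : 'I_n -> R) rho : (0 < n)%N ->
  (forall i j, 0 <= M i j) -> M^T = M -> 0 < \sum_i x i ^+ 2 ->
  rho * \sum_i x i ^+ 2 <= \sum_i \sum_j x i * M i j * x j ->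
  rho <= spectral_radius M.
Proof.
move=> n0 M0 MT xpos le_form; have := le_trans le_form (rayleigh_le x n0 M0 MT).
by rewrite ler_pM2r.
Qed.

Lemma rayleigh_tight n (M : 'M[R]_n) (x : 'I_n -> R) rho : (0 < n)%N ->
  (forall i j, 0 <= M i j) -> M^T = M -> 0 < \sum_i x i ^+ 2 ->
  rho * \sum_i x i ^+ 2 <= \sum_i \sum_j x i * M i j * x j ->
  spectral_radius M <= rho ->
  \sum_i \sum_j x i * M i j * x j = rho * \sum_i x i ^+ 2 /\
  forall i, \sum_j M i j * x j = rho * x i.
Proof.
move=> n0 M0 MT xpos le_form sr_le.
have srE : spectral_radius M = rho.
  by apply/eqP; rewrite eq_le sr_le (rayleigh_lower n0 M0 MT xpos).
have formE : \sum_i \sum_j x i * M i j * x j = rho * \sum_i x i ^+ 2.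
  by apply/eqP; rewrite eq_le le_form andbT -srE rayleigh_le.
by split=> // i; rewrite -srE; apply: rayleigh_eq => //; rewrite srE.
Qed.

Lemma nonneg_combination_eq0 (c1 c2 y t : R) : 0 < c1 -> 0 < c2 ->
  0 <= y -> 0 <= t -> c1 * y + c2 * t = 0 -> y = 0 /\ t = 0.
Proof.
move=> c1_gt0 c2_gt0 y0 t0 /eqP; rewrite paddr_eq0 ?(mulr_ge0 (ltW c1_gt0)) ?(mulr_ge0 (ltW c2_gt0)) //.
by rewrite !mulf_eq0 (gt_eqF c1_gt0) (gt_eqF c2_gt0) //= => /andP [/eqP-> /eqP->].
Qed.

Lemma sum2_eq0 n (f : 'I_n -> 'I_n -> R) : (forall i j, 0 <= f i j) ->
  \sum_i \sum_j f i j = 0 -> forall i j, f i j = 0.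
Proof.
move=> f0 sum0 i j; apply/eqP; rewrite eq_le f0 andbT.
rewrite -sum0 (bigD1 i) //= (bigD1 j) //= -addrA lerDl addr_ge0 //.
  by apply: sumr_ge0.
by apply: sumr_ge0 => i' _; apply: sumr_ge0.
Qed.

Variables (n : nat) (M : 'M[R]_n) (d : 'I_n -> nat) (q r : nat).
Hypothesis n_gt0 : (0 < n)%N.
Hypothesis M_ge0 : forall i j, 0 <= M i j.
Hypothesis M_sym : M^T = M.
Hypothesis M_row : forall i, \sum_j M i j = (d i)%:R.
Hypothesis sum_d : (\sum_i d i = n * q + r)%N.

Let a i : R := (q < d i)%:R.
Let D : R := (n * q + r)%:R.
Let S : R := \sum_i a i * (d i)%:R.
(** T and T' measure how far the rows of sum larger than q, respectively the
    other rows, are from being independent. *)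
Let T : R := \sum_i \sum_j a i * M i j * a j.
Let T' : R := \sum_i \sum_j (1 - a i) * M i j * (1 - a j).
Let k : R := \sum_i a i.

Let a01 i : 0 <= a i <= 1.
Proof. by rewrite /a; case: ltnP; rewrite !lexx !ler01. Qed.

Let sum_dR : \sum_i (d i)%:R = D.
Proof. by rewrite -natr_sum sum_d. Qed.

Let sum_row_a : \sum_i \sum_j a i * M i j = S.
Proof. by apply: eq_bigr => i _; rewrite -mulr_sumr M_row. Qed.

Let sum_col_a : \sum_i \sum_j M i j * a j = S.
Proof.
rewrite exchange_big /= -sum_row_a; apply: eq_bigr => i _; apply: eq_bigr => j _.
by rewrite -{1}M_sym mxE mulrC.
Qed.

Let sum_all : \sum_i \sum_j M i j = D.
Proof. by rewrite -sum_dR; apply: eq_bigr. Qed.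

Let sum2D (f g : 'I_n -> 'I_n -> R) :
  \sum_i \sum_j (f i j + g i j) = \sum_i \sum_j f i j + \sum_i \sum_j g i j.
Proof. by rewrite -big_split /=; apply: eq_bigr => i _; rewrite big_split. Qed.

Let sum2Z c (f : 'I_n -> 'I_n -> R) :
  \sum_i \sum_j (c * f i j) = c * \sum_i \sum_j f i j.
Proof. by rewrite mulr_sumr; apply: eq_bigr => i _; rewrite mulr_sumr. Qed.

Lemma form_two_level u v :
  \sum_i \sum_j (v + (u - v) * a i) * M i j * (v + (u - v) * a j) =
  v ^+ 2 * D + 2 * v * (u - v) * S + (u - v) ^+ 2 * T.
Proof.
transitivity (\sum_i \sum_j (v ^+ 2 * M i j + (v * (u - v)) * (a i * M i j) +
   (v * (u - v)) * (M i j * a j) + (u - v) ^+ 2 * (a i * M i j * a j))).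
  by apply: eq_bigr => i _; apply: eq_bigr => j _; ring.
rewrite !sum2D !sum2Z sum_all sum_row_a sum_col_a -/T; ring.
Qed.

Lemma norm_two_level u v :
  \sum_i (v + (u - v) * a i) ^+ 2 = v ^+ 2 * n%:R + (u ^+ 2 - v ^+ 2) * k.
Proof.
transitivity (\sum_i (v ^+ 2 + (u ^+ 2 - v ^+ 2) * a i)).
  by apply: eq_bigr => i _; rewrite /a; case: (_ < _)%N => /=; ring.
by rewrite big_split /= -[X in _ + X]mulr_sumr sumr_const card_ord -[v ^+ 2 *+ n]mulr_natr.
Qed.

Lemma sum_T' : T' = D - 2 * S + T.
Proof.
transitivity (\sum_i \sum_j (M i j + -1 * (a i * M i j) +
   -1 * (M i j * a j) + (a i * M i j * a j))).
  by apply: eq_bigr => i _; apply: eq_bigr => j _; ring.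
rewrite !sum2D !sum2Z sum_all sum_row_a sum_col_a -/T; ring.
Qed.

Let T_ge0 : 0 <= T.
Proof.
by apply: sumr_ge0 => i _; apply: sumr_ge0 => j _; rewrite !mulr_ge0 // (andP (a01 _)).1.
Qed.

Let T'_ge0 : 0 <= T'.
Proof.
by apply: sumr_ge0 => i _; apply: sumr_ge0 => j _; rewrite !mulr_ge0 // subr_ge0 (andP (a01 _)).2.
Qed.

Let T_eq0 : T = 0 -> forall i j, (q < d i)%N -> (q < d j)%N -> M i j = 0.
Proof.
move=> T0 i j qi qj.
have pos i' j' : 0 <= a i' * M i' j' * a j' by rewrite !mulr_ge0 // (andP (a01 _)).1.
have := sum2_eq0 pos T0 i j.
by rewrite /a qi qj mul1r mulr1.
Qed.

Let T'_eq0 : T' = 0 -> forall i j, (d i <= q)%N -> (d j <= q)%N -> M i j = 0.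
Proof.
move=> T0 i j di dj.
have [qi qj] : (q < d i)%N = false /\ (q < d j)%N = false by rewrite !ltnNge di dj.
have pos i' j' : 0 <= (1 - a i') * M i' j' * (1 - a j').
  by rewrite !mulr_ge0 // subr_ge0 (andP (a01 _)).2.
have := sum2_eq0 pos T0 i j.
by rewrite /a qi qj subr0 mul1r mulr1.
Qed.

Let Y theta : R := S - theta * k - (q.+1%:R - theta) * r%:R.

(** With theta = q + tau, the difference equals tau (d - q - 1) on the upper level
    and (1 - tau) (q - d) on the lower one. *)
Lemma excess_term theta i : q%:R < theta < q.+1%:R ->
  0 <= a i * ((d i)%:R - theta) - (q.+1%:R - theta) * ((d i)%:R - q%:R) ?= iff
    (d i == q + (q < d i))%N.
Proof.
rewrite -natr1 => /andP [lo hi]; rewrite /a; apply/leifP; case: ifP => [/eqP di|/eqP di].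
  move: di; case: ltnP => _ di.
    by rewrite {}di natrD /=; apply/eqP; ring.
  by rewrite {}di addn0 /=; apply/eqP; ring.
move: di; case: ltnP => qd di.
  have : (q + 2 <= d i)%N by lia.
  rewrite -(ler_nat R) natrD /= => qd2.
  by have := mulr_gt0 (_ : 0 < theta - q%:R) (_ : 0 < (d i)%:R - q%:R - 1); lra.
have : (d i + 1 <= q)%N by lia.
rewrite -(ler_nat R) natrD /= => qd1.
by have := mulr_gt0 (_ : 0 < q%:R + 1 - theta) (_ : 0 < q%:R - (d i)%:R); lra.
Qed.

(** The terms of [excess_term] add up to [Y theta] because the numbers d - q have
    sum r. *)
Lemma excess theta : q%:R < theta < q.+1%:R -> 0 <= Y theta /\
  (Y theta = 0 -> forall i, d i = (q + (q < d i))%N).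
Proof.
move=> th.
have YE : Y theta = \sum_i (a i * ((d i)%:R - theta) - (q.+1%:R - theta) * ((d i)%:R - q%:R)).
  rewrite sumrB -mulr_sumr sumrB sum_dR sumr_const card_ord.
  under eq_bigr => i _ do rewrite mulrBr.
  rewrite sumrB -/S -mulr_suml -/k /Y /D natrD natrM -[q%:R *+ n]mulr_natl; ring.
rewrite YE; split.
  by apply: sumr_ge0 => i _; rewrite (excess_term i th).
move/eqP; rewrite psumr_eq0; last by move=> i _; rewrite (excess_term i th).
move=> /allP al i; have := al i; rewrite mem_index_enum => /(_ isT) /=.
by rewrite eq_sym (excess_term i th) => /eqP.
Qed.

Let sum_sq_gt0 u v : 0 <= v -> v < u -> (0 < r)%N ->
  0 < \sum_i (v + (u - v) * a i) ^+ 2.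
Proof.
move=> v0 vu r0.
have [i qi] : exists i, (q < d i)%N.
  apply/existsP; rewrite -[[exists _, _]]negbK negb_exists; apply/forallP => le_q.
  suff : (\sum_i d i <= n * q)%N by rewrite sum_d; lia.
  have -> : (n * q = \sum_(i < n) q)%N by rewrite sum_nat_const card_ord.
  apply: leq_sum => i _.
  by have := le_q i; rewrite -leqNgt.
rewrite (bigD1 i) //= /a qi mulr1 [v + _]addrC subrK ltr_pwDl ?exprn_gt0 //.
  exact: le_lt_trans vu.
by apply: sumr_ge0 => j _; apply: sqr_ge0.
Qed.

(** The test vector (q+1 on the rows of sum larger than q, rho on the others) is
    the Perron vector of the quotient matrix [[0, q+1], [c, q-c]] with
    c = r(q+1)/(n-r); the equation for rho is its characteristic equation.  The
    value theta = (q+1+rho)/2 is the one for which the number of rows of sum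
    larger than q enters the gap only through the excess. *)
Lemma upper_level_independent rho : (0 < r)%N -> q%:R < rho < q.+1%:R ->
  n%:R * rho * (rho - q%:R) = r%:R * (rho + (q.+1%:R - rho) ^+ 2) ->
  rho <= spectral_radius M /\ (spectral_radius M <= rho ->
   [/\ forall i, d i = (q + (q < d i))%N,
       forall i j, (q < d i)%N -> (q < d j)%N -> M i j = 0
     & forall i, \sum_j M i j * (rho + (q.+1%:R - rho) * a j) =
                 rho * (rho + (q.+1%:R - rho) * a i)]).
Proof.
move=> r0 /andP [lo hi] rhoE.
have rho0 : 0 < rho by apply: le_lt_trans lo.
have th : q%:R < (q.+1%:R + rho) / 2 < q.+1%:R.
  by move: lo hi; rewrite -natr1 => ? ?; apply/andP; split; lra.
have [Y0 Yeq] := excess th.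
pose x i := rho + (q.+1%:R - rho) * a i.
have gap : \sum_i \sum_j x i * M i j * x j - rho * \sum_i x i ^+ 2 =
    2 * rho * (q.+1%:R - rho) * Y ((q.+1%:R + rho) / 2) + (q.+1%:R - rho) ^+ 2 * T.
  rewrite form_two_level norm_two_level /Y /D natrD natrM.
  apply/eqP; rewrite -subr_eq0; apply/eqP.
  (* What remains is the equation for rho, multiplied by rho. *)
  transitivity (rho * (r%:R * (rho + (q.+1%:R - rho) ^+ 2) - n%:R * rho * (rho - q%:R))).
    by rewrite -natr1; field.
  by rewrite rhoE subrr mulr0.
have le_form : rho * \sum_i x i ^+ 2 <= \sum_i \sum_j x i * M i j * x j.
  rewrite -subr_ge0 gap addr_ge0 ?mulr_ge0 ?sqr_ge0 // ?subr_ge0 ltW //.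
have xpos : 0 < \sum_i x i ^+ 2 by apply: sum_sq_gt0 => //; exact: ltW.
split; first exact: rayleigh_lower le_form.
move=> /(rayleigh_tight n_gt0 M_ge0 M_sym xpos le_form) [formE Mx].
have c1 : 0 < 2 * rho * (q.+1%:R - rho) by rewrite !mulr_gt0 // subr_gt0.
have c2 : 0 < (q.+1%:R - rho) ^+ 2 by rewrite exprn_gt0 // subr_gt0.
move: gap; rewrite formE subrr => /esym gap0.
have [||Yz Tz] := nonneg_combination_eq0 c1 c2 _ _ gap0 => //.
by split=> //; [exact: Yeq | exact: T_eq0].
Qed.

(** The test vector (rho on the rows of sum larger than q, q on the others) is the
    Perron vector of the quotient matrix [[q+1-b, b], [q, 0]] with b = (n-r)q/r.
    For q = 0 it is supported on the upper level, and rho = 1. *)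
Lemma lower_level_independent rho : (0 < r)%N -> q%:R < rho <= q.+1%:R ->
  n%:R * q%:R * (rho - q%:R) = r%:R * (q%:R + (q.+1%:R - rho) * (rho - q%:R)) ->
  rho <= spectral_radius M /\ (spectral_radius M <= rho ->
   [/\ forall i, d i = (q + (q < d i))%N,
       forall i j, (d i <= q)%N -> (d j <= q)%N -> M i j = 0
     & forall i, \sum_j M i j * (q%:R + (rho - q%:R) * a j) =
                 rho * (q%:R + (rho - q%:R) * a i)]).
Proof.
move=> r0 /andP [lo hi] rhoE.
have rho0 : 0 < rho by apply: le_lt_trans lo.
have th : q%:R < (rho + q%:R) / 2 < q.+1%:R.
  by move: lo hi; rewrite -natr1 => ? ?; apply/andP; split; lra.
have [Y0 Yeq] := excess th.
pose x i := q%:R + (rho - q%:R) * a i.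
have gap : \sum_i \sum_j x i * M i j * x j - rho * \sum_i x i ^+ 2 =
    2 * rho * (rho - q%:R) * Y ((rho + q%:R) / 2) + (rho - q%:R) ^+ 2 * T'.
  rewrite form_two_level norm_two_level sum_T' /Y /D natrD natrM.
  apply/eqP; rewrite -subr_eq0; apply/eqP.
  (* What remains is the equation for rho, multiplied by rho. *)
  transitivity (rho * (r%:R * (q%:R + (q.+1%:R - rho) * (rho - q%:R)) -
    n%:R * q%:R * (rho - q%:R))).
    by rewrite -natr1; field.
  by rewrite rhoE subrr mulr0.
have le_form : rho * \sum_i x i ^+ 2 <= \sum_i \sum_j x i * M i j * x j.
  rewrite -subr_ge0 gap addr_ge0 ?mulr_ge0 ?sqr_ge0 // ?subr_ge0 ltW //.
have xpos : 0 < \sum_i x i ^+ 2 by apply: sum_sq_gt0.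
split; first exact: rayleigh_lower le_form.
move=> /(rayleigh_tight n_gt0 M_ge0 M_sym xpos le_form) [formE Mx].
have c1 : 0 < 2 * rho * (rho - q%:R) by rewrite !mulr_gt0 // subr_gt0.
have c2 : 0 < (rho - q%:R) ^+ 2 by rewrite exprn_gt0 // subr_gt0.
move: gap; rewrite formE subrr => /esym gap0.
have [||Yz Tz] := nonneg_combination_eq0 c1 c2 _ _ gap0 => //.
by split=> //; [exact: Yeq | exact: T'_eq0].
Qed.
End TwoLevel.

(** * The optimal value and a matrix attaining it *)

Lemma sum_ltn (n r : nat) : (\sum_(i < n) (i < r)%N = minn n r)%N.
Proof.
elim: n => [|n IHn]; first by rewrite big_ord0 min0n.
by rewrite big_ord_recr /= IHn; lia.
Qed.

Section Optimum.
Variable R : realType.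

(** The difference of the two sides changes sign between q and q+1. *)
Lemma upper_level_root (n q r : nat) : (0 < r < n)%N -> exists rho : R,
  q%:R < rho < q.+1%:R /\
  n%:R * rho * (rho - q%:R) = r%:R * (rho + (q.+1%:R - rho) ^+ 2).
Proof.
move=> /andP [r0 rn].
pose p : {poly R} := n%:R *: ('X * ('X - q%:R%:P)) -
  r%:R *: ('X + (q.+1%:R%:P - 'X) ^+ 2).
have pE x : p.[x] = n%:R * x * (x - q%:R) - r%:R * (x + (q.+1%:R - x) ^+ 2).
  by rewrite /p !hornerE.
have rR : 0 < r%:R :> R by rewrite ltr0n.
have rnR : r%:R < n%:R :> R by rewrite ltr_nat.
have q0 : 0 <= q%:R :> R by rewrite ler0n.
have plo : p.[q%:R] < 0.
  by rewrite pE -natr1 subrr mulr0 sub0r oppr_lt0 mulr_gt0 //; nra.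
have phi : 0 < p.[q.+1%:R].
  rewrite pE -natr1 subrr expr0n /= addr0 [q%:R + 1 - _]addrAC subrr add0r mulr1.
  by rewrite -mulrBl mulr_gt0 ?subr_gt0 //; lra.
have le_q : q%:R <= q.+1%:R :> R by rewrite ler_nat.
case: (poly_ivt le_q (_ : p.[q%:R] <= 0 <= p.[q.+1%:R])); first by rewrite !ltW.
move=> rho /andP [rho_lo rho_hi] /rootP prho; exists rho; split.
  rewrite !lt_neqAle rho_lo rho_hi !andbT; apply/andP; split; apply/eqP => E.
    by move: plo; rewrite E prho ltxx.
  by move: phi; rewrite -E prho ltxx.
by apply/eqP; rewrite -subr_eq0 -pE prho.
Qed.

(** As for [upper_level_root], except that for q = 0 the difference vanishes at
    both ends of the interval and the root to be taken is q+1. *)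
Lemma lower_level_root (n q r : nat) : (0 < r < n)%N -> exists rho : R,
  q%:R < rho <= q.+1%:R /\
  n%:R * q%:R * (rho - q%:R) = r%:R * (q%:R + (q.+1%:R - rho) * (rho - q%:R)).
Proof.
move=> /andP [r0 rn].
case: (posnP q) => [->|q_gt0].
  by exists 1; rewrite ltr01 lexx; split=> //; ring.
pose p : {poly R} := (n%:R * q%:R) *: ('X - q%:R%:P) -
  r%:R *: (q%:R%:P + (q.+1%:R%:P - 'X) * ('X - q%:R%:P)).
have pE x : p.[x] = n%:R * q%:R * (x - q%:R) - r%:R * (q%:R + (q.+1%:R - x) * (x - q%:R)).
  by rewrite /p !hornerE.
have rR : 0 < r%:R :> R by rewrite ltr0n.
have rnR : r%:R < n%:R :> R by rewrite ltr_nat.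
have q0 : 0 < q%:R :> R by rewrite ltr0n.
have plo : p.[q%:R] < 0.
  by rewrite pE subrr !mulr0 addr0 sub0r oppr_lt0 mulr_gt0.
have phi : 0 < p.[q.+1%:R].
  rewrite pE -natr1 subrr mul0r addr0 [q%:R + 1 - _]addrAC subrr add0r mulr1.
  by rewrite -mulrBl mulr_gt0 ?subr_gt0.
have le_q : q%:R <= q.+1%:R :> R by rewrite ler_nat.
case: (poly_ivt le_q (_ : p.[q%:R] <= 0 <= p.[q.+1%:R])); first by rewrite !ltW.
move=> rho /andP [rho_lo rho_hi] /rootP prho; exists rho; split.
  rewrite lt_neqAle rho_lo rho_hi !andbT; apply/eqP => E.
  by move: plo; rewrite E prho ltxx.
by apply/eqP; rewrite -subr_eq0 -pE prho.
Qed.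

Section Upper.
Variables (n : nat) (M : 'M[R]_n) (A : pred 'I_n) (q : nat) (rho : R).
Hypothesis n_gt0 : (0 < n)%N.
Hypothesis M_ge0 : forall i j, 0 <= M i j.
Hypothesis M_sym : M^T = M.
Hypothesis M_row : forall i, \sum_j M i j = (q + A i)%:R.

Lemma two_value_radius_le u v : 0 < u -> 0 < v ->
  (forall i, \sum_j M i j * (v + (u - v) * (A j)%:R) <=
             rho * (v + (u - v) * (A i)%:R)) ->
  spectral_radius M <= rho.
Proof.
move=> u0 v0 Mx; apply: (@spectral_radius_le _ _ M (fun i => v + (u - v) * (A i)%:R)) => //.
  by move=> i; case: (A i); rewrite /= ?mulr0 ?addr0 // mulr1 addrC subrK.
move=> j; apply: le_trans (Mx j); apply: ler_sum => i _.
by rewrite -{1}M_sym mxE mulrC.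
Qed.

Let two_value_row u v i : \sum_j M i j * (v + (u - v) * (A j)%:R) =
  v * (q + A i)%:R + (u - v) * \sum_j M i j * (A j)%:R.
Proof.
rewrite -M_row !mulr_sumr -big_split /=; apply: eq_bigr => j _; ring.
Qed.

Lemma upper_level_radius_le c : 0 < rho ->
  (forall i, \sum_j M i j * (A j)%:R = if A i then 0 else c) ->
  c * q.+1%:R + (q%:R - c) * rho = rho ^+ 2 ->
  spectral_radius M <= rho.
Proof.
move=> rho0 MA cE; apply: (@two_value_radius_le q.+1%:R rho) => // i.
rewrite two_value_row MA; case: (A i) => /=.
  by rewrite addn1 -natr1; rewrite le_eqVlt; apply/orP; left; apply/eqP; ring.
by rewrite addn0 !mulr0 addr0 -expr2 -cE; rewrite le_eqVlt; apply/orP; left; apply/eqP; ring.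
Qed.

(** The vector (rho, q) is positive unless q = 0; in that case all the row sums
    are at most 1, and the constant vector does. *)
Lemma lower_level_radius_le b : 0 < rho -> 1 <= rho ->
  (forall i, \sum_j M i j * (A j)%:R = if A i then q.+1%:R - b else q%:R) ->
  (q.+1%:R - b) * rho + b * q%:R = rho ^+ 2 ->
  spectral_radius M <= rho.
Proof.
move=> rho0 rho1 MA bE; case: (posnP q) => [q0|q_gt0].
  apply: (@two_value_radius_le 1 1) => // i.
  rewrite subrr mul0r addr0 mulr1; apply: le_trans rho1.
  under eq_bigr do rewrite mul0r addr0 mulr1.
  by rewrite M_row q0; case: (A i).
apply: (@two_value_radius_le rho q%:R) => // [|i]; first by rewrite ltr0n.
rewrite two_value_row MA; case: (A i) => /=.
  rewrite mulr1 [q%:R + _]addrC subrK -expr2 -bE addn1 -natr1; rewrite le_eqVlt; apply/orP; left; apply/eqP; ring.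
by rewrite addn0 mulr0 addr0; rewrite le_eqVlt; apply/orP; left; apply/eqP; ring.
Qed.

End Upper.

Lemma sum_initial (n r : nat) (x y : R) : (r <= n)%N ->
  \sum_(j < n) (if (j < r)%N then x else y) = r%:R * x + (n - r)%:R * y.
Proof.
move=> le_rn; rewrite -(big_mkord xpredT (fun j => if (j < r)%N then x else y)).
rewrite (@big_cat_nat _ _ _ r) //=; congr (_ + _).
  rewrite (eq_big_nat _ _ (F2 := fun=> x)); last by move=> i /andP [_ ->].
  by rewrite big_const_nat subn0 iter_addr_0 mulr_natl.
rewrite (eq_big_nat _ _ (F2 := fun=> y)); last first.
  by move=> i /andP [ri _]; rewrite ltnNge ri.
by rewrite big_const_nat iter_addr_0 mulr_natl.
Qed.

Section Block.
Variables (n r q e : nat) (alpha beta gamma : R).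
Hypothesis le_rn : (r <= n)%N.
Hypothesis edge_count : (2 * e = n * q + r)%N.
Hypothesis (alpha_ge0 : 0 <= alpha) (beta_ge0 : 0 <= beta) (gamma_ge0 : 0 <= gamma).
Hypothesis upper_row : r%:R * alpha + (n - r)%:R * beta = q.+1%:R.
Hypothesis lower_row : r%:R * beta + (n - r)%:R * gamma = q%:R.

Definition two_block_mx : 'M[R]_n := \matrix_(i, j)
  if (i < r)%N then (if (j < r)%N then alpha else beta)
  else (if (j < r)%N then beta else gamma).

Lemma two_block_mx_sym : two_block_mx^T = two_block_mx.
Proof. by apply/matrixP => i j; rewrite !mxE; do 2 case: ifP. Qed.

Lemma two_block_mx_ge0 i j : 0 <= two_block_mx i j.
Proof. by rewrite mxE; do 2 case: ifP. Qed.

Lemma two_block_mx_row i : \sum_j two_block_mx i j = (q + (i < r))%:R.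
Proof.
rewrite (eq_bigr (fun j : 'I_n => if (j < r)%N then (if (i < r)%N then alpha else beta)
    else (if (i < r)%N then beta else gamma))); last first.
  by move=> j _; rewrite mxE; do 2 case: ifP.
rewrite sum_initial //; case: ifP => _.
  by rewrite upper_row addn1.
by rewrite lower_row addn0.
Qed.

Lemma two_block_mx_row_upper i : \sum_j two_block_mx i j * (j < r)%:R =
  if (i < r)%N then r%:R * alpha else r%:R * beta.
Proof.
transitivity (\sum_(j < n) (if (j < r)%N then
    (if (i < r)%N then alpha else beta) else 0)).
  by apply: eq_bigr => j _; rewrite mxE; case: (j < r)%N; rewrite ?mulr1 ?mulr0.
by rewrite sum_initial // mulr0 addr0; case: ifP.
Qed.

Lemma two_block_mx_integral : integral_row_matrices R n e two_block_mx.
Proof.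
split; [exact: two_block_mx_sym | exact: two_block_mx_ge0 | |].
  by move=> i; rewrite two_block_mx_row; apply: natr_int.
under eq_bigr do rewrite two_block_mx_row.
rewrite -natr_sum edge_count big_split /= sum_nat_const card_ord; congr (_ + _)%:R.
by rewrite sum_ltn (minn_idPr le_rn).
Qed.

End Block.
End Optimum.

(** * Graphs made of circulant and biregular blocks *)

Section Graphs.
Local Open Scope nat_scope.

(** Subtraction in Z/N, with a case distinction instead of a remainder so that
    it stays within linear arithmetic. *)
Definition cyclic_diff N i j := if j <= i then i - j else i + N - j.

Lemma cyclic_diff_lt N i j : i < N -> j < N -> cyclic_diff N i j < N.
Proof. by rewrite /cyclic_diff => iN jN; case: ifP => ij; lia. Qed.

Lemma sum_cyclic_diffl N u (F : nat -> nat) : u < N ->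
  \sum_(j < N) F (cyclic_diff N j u) = \sum_(k < N) F k.
Proof.
move=> uN; pose h (j : 'I_N) : 'I_N := Ordinal (cyclic_diff_lt (ltn_ord j) uN).
rewrite [RHS](reindex_inj (h := h)) // => i j [] /eqP.
have := ltn_ord i; have := ltn_ord j; rewrite /cyclic_diff => ? ? e.
by apply: val_inj => /=; move: e; case: ifP => ?; case: ifP => ?; lia.
Qed.

Lemma sum_cyclic_diffr N u (F : nat -> nat) : u < N ->
  \sum_(j < N) F (cyclic_diff N u j) = \sum_(k < N) F k.
Proof.
move=> uN; pose h (j : 'I_N) : 'I_N := Ordinal (cyclic_diff_lt uN (ltn_ord j)).
rewrite [RHS](reindex_inj (h := h)) // => i j [] /eqP.
have := ltn_ord i; have := ltn_ord j; rewrite /cyclic_diff => ? ? e.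
by apply: val_inj => /=; move: e; case: ifP => ?; case: ifP => ?; lia.
Qed.

(** A k-regular circulant graph on Z/N: the differences allowed are those at
    distance at most k/2 from 0, together with N/2 when k is odd. *)
Definition circulant N k i j :=
  let d := cyclic_diff N i j in
  (0 < d) && [|| d <= k./2, N - d <= k./2 | odd k && (d.*2 == N)].

Lemma circulant_irr N k i : circulant N k i i = false.
Proof. by rewrite /circulant /cyclic_diff leqnn subnn. Qed.

Lemma circulant_sym N k i j : i < N -> j < N -> circulant N k i j = circulant N k j i.
Proof.
rewrite /circulant /cyclic_diff => iN jN.
by case: (ltngtP i j) => [ij|ji|->//]; case: (odd k); apply/idP/idP; lia.
Qed.

(** The connection set is described through initial segments of [0, N), whose
    indicators are summed by [sum_ltn]; for odd k the number N is even. *)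
Lemma circulant_degree N k i : i < N -> k < N -> ~~ odd (N * k) ->
  \sum_(j < N) circulant N k i j = k.
Proof.
move=> iN kN even_Nk.
pose F d : nat := (0 < d) && [|| d <= k./2, N - d <= k./2 | odd k && (d.*2 == N)].
rewrite (sum_cyclic_diffr F) //.
have FE (d : 'I_N) : F d + ((d < 1) + (d < N - k./2)) =
    (d < k./2.+1) + (1 + odd k * ((d < N./2.+1) - (d < N./2))).
  have := odd_double_half k; have := odd_double_half N; have := ltn_ord d.
  by move: even_Nk; rewrite /F oddM; case: (odd k); case: (odd N) => //=; lia.
have : \sum_(d < N) (F d + ((d < 1) + (d < N - k./2))) =
    \sum_(d < N) ((d < k./2.+1) + (1 + odd k * ((d < N./2.+1) - (d < N./2)))).
  by apply: eq_bigr => d _; apply: FE.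
rewrite !big_split /= -big_distrr /= sumnB; last by move=> d _; lia.
rewrite !sum_ltn sum_nat_const card_ord muln1.
have := odd_double_half k; have := odd_double_half N.
by move: even_Nk; rewrite oddM; case: (odd k); case: (odd N) => //=; lia.
Qed.

(** The neighbours of the left vertex i form a window of b consecutive residues
    modulo s; the window of i+1 starts where that of i ends, so that the windows
    cover the residues evenly. *)
Definition biregular s b i j := cyclic_diff s j ((i * b) %% s) < b.

Lemma biregular_row s b i : 0 < s -> b <= s -> \sum_(j < s) biregular s b i j = b.
Proof.
move=> s0 bs; rewrite (sum_cyclic_diffl (fun d => d < b)) ?ltn_mod //.
by rewrite sum_ltn; lia.
Qed.

Lemma sum_blocks r b (F : nat -> nat) :
  \sum_(i < r) \sum_(t < b) F (i * b + t) = \sum_(m < r * b) F m.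
Proof.
elim: r => [|r IHr]; first by rewrite !big_ord0.
by rewrite big_ord_recr /= IHr mulSnr big_split_ord.
Qed.

Lemma count_residue s c j : j < s -> \sum_(m < c * s) (m %% s == j) = c.
Proof.
move=> js; rewrite -(sum_blocks c s (fun m => m %% s == j)).
rewrite (eq_bigr (fun=> 1)) ?sum_nat_const ?card_ord ?muln1 // => i _.
rewrite (bigD1 (Ordinal js)) //= modnMDl modn_small // eqxx big1 // => t tj.
rewrite modnMDl modn_small //; apply/eqP; rewrite eqb0.
by apply: contraNN tj => /eqP tj; apply/eqP/val_inj.
Qed.

Lemma biregular_window s b i j : j < s -> b <= s ->
  biregular s b i j = \sum_(t < b) ((i * b + t) %% s == j) :> nat.
Proof.
move=> js bs; rewrite /biregular; set u := (i * b) %% s.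
have us : u < s by rewrite ltn_mod; lia.
have E (t : 'I_b) : ((i * b + t) %% s == j) = (t == cyclic_diff s j u :> nat).
  rewrite -modnDml -/u; have tb := ltn_ord t; rewrite /cyclic_diff.
  have [uts|sut] := ltnP (u + t) s.
    by rewrite modn_small //; case: ifP => ?; lia.
  rewrite -[u + t](subnK sut) modnDr modn_small; last by lia.
  by case: ifP => ?; lia.
under eq_bigr do rewrite E.
have [lt_b|ge_b] := ltnP (cyclic_diff s j u) b.
  rewrite (bigD1 (Ordinal lt_b)) //= eqxx big1 // => t tj.
  by apply/eqP; rewrite eqb0; apply: contraNN tj => /eqP tj; apply/eqP/val_inj.
by rewrite big1 // => t _; have := ltn_ord t; lia.
Qed.

(** The windows of the r left vertices concatenate to [0, rb) = [0, sc), which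
    meets every residue class exactly c times. *)
Lemma biregular_col r s b c j : j < s -> b <= s -> r * b = s * c ->
  \sum_(i < r) biregular s b i j = c.
Proof.
move=> js bs E; under eq_bigr => i _ do rewrite biregular_window //.
by rewrite (sum_blocks r b (fun m => m %% s == j)) E mulnC count_residue.
Qed.

Definition two_part_graph r s a b d : rel 'I_(r + s) := fun i j =>
  if i < r then
    if j < r then circulant r a i j else biregular s b i (j - r)
  else
    if j < r then biregular s b j (i - r) else circulant s d (i - r) (j - r).

Section TwoPart.
Variables r s a b c d : nat.
Local Notation g := (@two_part_graph r s a b d).

Lemma two_part_graph_sym : symmetric g.
Proof.
move=> i j; rewrite /two_part_graph; have := ltn_ord i; have := ltn_ord j.
by case: (ltnP i r) => ?; case: (ltnP j r) => ? // ? ?; rewrite circulant_sym //; lia.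
Qed.

Lemma two_part_graph_irr : irreflexive g.
Proof. by move=> i; rewrite /two_part_graph; case: ifP => ir; rewrite ir circulant_irr. Qed.

Lemma two_part_graph_upper_upper (i : 'I_(r + s)) : a < r -> ~~ odd (r * a) ->
  i < r -> \sum_(j < r + s | j < r) g i j = a.
Proof.
move=> a_lt even_a ir; rewrite big_split_ord /= [X in _ + X]big1 ?addn0; last by move=> j; lia.
rewrite (eq_bigl xpredT); last by move=> j; rewrite /= ltn_ord.
under eq_bigr => j _ do rewrite /two_part_graph /= ir ltn_ord.
exact: circulant_degree.
Qed.

Lemma two_part_graph_upper_lower (i : 'I_(r + s)) : 0 < s -> b <= s ->
  i < r -> \sum_(j < r + s | ~~ (j < r)) g i j = b.
Proof.
move=> s_gt0 b_le ir; rewrite big_split_ord /= [X in X + _]big1 ?add0n; last first.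
  by move=> j; have := ltn_ord j; lia.
rewrite (eq_bigl xpredT); last by move=> j; rewrite /=; lia.
under eq_bigr => j _ do rewrite /two_part_graph /= ir ltnNge leq_addr addKn /=.
exact: biregular_row.
Qed.

Lemma two_part_graph_lower_upper (i : 'I_(r + s)) : b <= s -> r * b = s * c ->
  ~~ (i < r) -> \sum_(j < r + s | j < r) g i j = c.
Proof.
move=> b_le bip ir; rewrite big_split_ord /= [X in _ + X]big1 ?addn0; last by move=> j; lia.
rewrite (eq_bigl xpredT); last by move=> j; rewrite /= ltn_ord.
under eq_bigr => j _ do rewrite /two_part_graph /= (negPf ir) ltn_ord.
by apply: biregular_col => //; have := ltn_ord i; lia.
Qed.

Lemma two_part_graph_lower_lower (i : 'I_(r + s)) : d < s -> ~~ odd (s * d) ->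
  ~~ (i < r) -> \sum_(j < r + s | ~~ (j < r)) g i j = d.
Proof.
move=> d_lt even_d ir; rewrite big_split_ord /= [X in X + _]big1 ?add0n; last first.
  by move=> j; have := ltn_ord j; lia.
rewrite (eq_bigl xpredT); last by move=> j; rewrite /=; lia.
under eq_bigr => j _ do rewrite /two_part_graph /= (negPf ir) ltnNge leq_addr addKn /=.
by apply: circulant_degree => //; have := ltn_ord i; lia.
Qed.
End TwoPart.

End Graphs.

(** * Arithmetic of optimal graphs *)

Section GraphMatrices.
Local Open Scope nat_scope.
Variables (n : nat) (g : rel 'I_n).
Hypothesis gP : simple_graph g.

Definition degree (i : 'I_n) : nat := \sum_j g i j.

(** An edge comes from exactly two ordered pairs of vertices. *)
Lemma handshake : \sum_i degree i = 2 * #|edges g|.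
Proof.
have [g_sym g_irr] := gP.
rewrite /degree pair_big /=.
rewrite (eq_bigr (fun p : 'I_n * 'I_n => if g p.1 p.2 then 1 else 0)); last first.
  by move=> p _; case: (g _ _).
rewrite -big_mkcond /=.
rewrite (eq_bigl (fun p => p \in [set p : 'I_n * 'I_n | g p.1 p.2]%SET)); last first.
  by move=> p; rewrite inE.
rewrite (partition_big_imset (fun p : 'I_n * 'I_n => [set p.1; p.2]%SET)) /=.
rewrite -/(edges g) mulnC -sum_nat_const; apply: eq_bigr => E /imsetP [[i j]].
rewrite inE /= => gij ->.
have ij : i != j by apply: contraTN gij => /eqP ->; rewrite g_irr.
rewrite (eq_bigl (fun p => p \in [set (i, j); (j, i)]%SET)).
  by rewrite sum1_card cards2 xpair_eqE (negPf ij).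
move=> [i' j']; rewrite !inE /= !xpair_eqE.
apply/andP/orP => [[gij' /eqP E']|].
  have ij' : i' != j' by apply: contraTN gij' => /eqP ->; rewrite g_irr.
  have := set21 i' j'; have := set22 i' j'; rewrite E' !inE => j'ij i'ij.
  case/orP: i'ij ij' => /eqP -> ij'; case/orP: j'ij ij' => /eqP ->; rewrite ?eqxx //; auto.
case=> /andP [/eqP -> /eqP ->]; first by rewrite gij eqxx.
by rewrite g_sym gij finset.setUC eqxx.
Qed.

Variables (q r : nat).
Let A i := q < degree i.
Hypothesis deg_eq : forall i, degree i = q + A i.
Hypothesis sum_deg : \sum_i degree i = n * q + r.
Hypothesis r_bounds : 0 < r < n.

Let card_A : #|[pred i | A i]| = r.
Proof.
apply: (@addnI (n * q)); rewrite -sum_deg (eq_bigr _ (fun i _ => deg_eq i)).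
rewrite big_split /= sum_nat_const card_ord -sum1_card [in LHS]big_mkcond.
by congr (_ + _); apply: eq_bigr => i _; rewrite inE; case: (A i).
Qed.

Let card_notA : #|[pred i | ~~ A i]| = n - r.
Proof. by rewrite -card_A -[X in _ = X - _](card_ord n) -(cardC [pred i | A i]) addKn; apply: eq_card. Qed.

Let exA : exists i, A i.
Proof.
have : 0 < #|[pred i | A i]| by rewrite card_A; case/andP: r_bounds.
by case/card_gt0P => i; exists i.
Qed.

Let exB : exists i, ~~ A i.
Proof.
have : 0 < #|[pred i | ~~ A i]| by rewrite card_notA; lia.
by case/card_gt0P => i; exists i.
Qed.

Let degree_split i : \sum_(j | A j) g i j + \sum_(j | ~~ A j) g i j = degree i.
Proof. by rewrite /degree [RHS](bigID A). Qed.

Let double_count : \sum_(i | A i) \sum_(j | ~~ A j) g i j =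
  \sum_(i | ~~ A i) \sum_(j | A j) g i j.
Proof.
rewrite exchange_big; apply: eq_bigr => i _; apply: eq_bigr => j _.
by have [-> _] := gP.
Qed.

Let sum_le_card (P : pred 'I_n) i : \sum_(j | P j) g i j <= #|P|.
Proof. by rewrite -sum1_card; apply: leq_sum => j _; case: (g i j). Qed.

(** Counting the edges between the levels from both sides gives
    r(q+1) = (n-r)c, and the q+1 neighbours of an upper vertex are among the n-r
    lower ones. *)
Lemma upper_structure_arith c :
  (forall i j, A i -> A j -> ~~ g i j) ->
  (forall i, ~~ A i -> \sum_(j | A j) g i j = c) ->
  (n - r %| r * q.+1) && (q.+1 <= n - r).
Proof.
move=> indep regB.
have degA i : A i -> \sum_(j | ~~ A j) g i j = q.+1.
  move=> Ai; rewrite -[RHS]addn1 -[X in _ + X]/(nat_of_bool true) -Ai -deg_eq -degree_split.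
  by rewrite [X in _ = X + _]big1 // => j Aj; rewrite (negPf (indep _ _ Ai Aj)).
apply/andP; split; last first.
  by have [i Ai] := exA; rewrite -(degA i Ai) -card_notA; apply: (sum_le_card (fun j => ~~ A j)).
apply/dvdnP; exists c.
have := double_count; rewrite (eq_bigr _ degA) (eq_bigr _ regB) !sum_nat_const.
by rewrite card_A card_notA mulnC [c * _]mulnC => <-; rewrite mulnC.
Qed.

(** Counting the edges between the levels from both sides gives
    r(q+1-c) = (n-r)q; the q neighbours of a lower vertex are among the r upper
    ones, and c < r because a vertex is not its own neighbour. *)
Lemma lower_structure_arith c :
  (forall i j, ~~ A i -> ~~ A j -> ~~ g i j) ->
  (forall i, A i -> \sum_(j | A j) g i j = c) ->
  [&& r %| (n - r) * q, q <= r & q.+2 <= r + (n - r) * q %/ r].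
Proof.
move=> indep regA.
have degB i : ~~ A i -> \sum_(j | A j) g i j = q.
  move=> Bi; rewrite -[RHS]addn0 -[X in _ + X]/(nat_of_bool false) -(negPf Bi) -deg_eq -degree_split.
  by rewrite [X in _ = _ + X]big1 ?addn0 // => j Bj; rewrite (negPf (indep _ _ Bi Bj)).
have degA i : A i -> c + \sum_(j | ~~ A j) g i j = q.+1.
  by move=> Ai; rewrite -(regA i Ai) degree_split deg_eq Ai addn1.
have degA' i : A i -> \sum_(j | ~~ A j) g i j = q.+1 - c.
  by move=> Ai; rewrite -(degA i Ai) addKn.
have lt_cr : c < r.
  have [i Ai] := exA; rewrite -(regA i Ai) -card_A.
  rewrite [X in _ < X](cardD1 i) inE Ai add1n ltnS (bigD1 i) //=.
  have [_ ->] := gP; rewrite add0n -sum1_card; apply: leq_trans (leq_sum _ _) _.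
  - by move=> j _; exact: (leq_b1 (g i j)).
  - by rewrite leq_eqVlt; apply/orP; left; apply/eqP; apply: eq_bigl => j; rewrite !inE andbC.
have le_c : c <= q.+1 by have [i Ai] := exA; have := degA i Ai; lia.
have E : r * (q.+1 - c) = (n - r) * q.
  have := double_count; rewrite (eq_bigr _ degA') (eq_bigr _ degB) !sum_nat_const.
  by rewrite card_A card_notA.
have r0 : 0 < r by lia.
rewrite -E dvdn_mulr // mulKn //=; apply/andP; split; last by lia.
by have [i Bi] := exB; rewrite -(degB i Bi) -[X in _ <= X]card_A; apply: (sum_le_card A).
Qed.

End GraphMatrices.

(** * When the two minima agree *)

(** The first branch is the regime in which the upper level of an optimal graph
    is independent.  In the second one an upper vertex has b = (n-r)q/r lower
    neighbours, hence q+1-b neighbours among the r-1 other upper vertices. *)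
Definition attainable (n q r : nat) : bool :=
  if (r * (2 * q + 1) <= q * n)%N
  then ((n - r %| r * q.+1) && (q.+1 <= n - r))%N
  else [&& r %| (n - r) * q, q <= r & q.+2 <= r + (n - r) * q %/ r]%N.

Section Agree.
Variable R : realType.

Section Adjacency.
Variables (n : nat) (g : rel 'I_n).
Hypothesis gP : simple_graph g.

Lemma adjacency_ge0 i j : 0 <= adjacency R g i j.
Proof. by rewrite mxE ler0n. Qed.

Lemma adjacency_sym : (adjacency R g)^T = adjacency R g.
Proof. by have [g_sym _] := gP; apply/matrixP => i j; rewrite !mxE g_sym. Qed.

Lemma adjacency_row i : \sum_j adjacency R g i j = (degree g i)%:R.
Proof. by rewrite /degree natr_sum; apply: eq_bigr => j _; rewrite mxE. Qed.

Lemma adjacency_row_in (A : pred 'I_n) i :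
  \sum_j adjacency R g i j * (A j)%:R = (\sum_(j | A j) g i j)%N%:R.
Proof.
rewrite natr_sum [RHS]big_mkcond; apply: eq_bigr => j _; rewrite mxE.
by case: (A j); rewrite /= ?mulr1 ?mulr0.
Qed.

Lemma adjacency_integral e : #|edges g| = e -> integral_row_matrices R n e (adjacency R g).
Proof.
move=> ge; split; [exact: adjacency_sym | exact: adjacency_ge0 | |].
  by move=> i; rewrite adjacency_row natr_int.
by under eq_bigr do rewrite adjacency_row; rewrite -natr_sum handshake // ge.
Qed.

End Adjacency.

Lemma integral_degrees n e (M : 'M[R]_n) : integral_row_matrices R n e M ->
  exists d : 'I_n -> nat, (forall i, \sum_j M i j = (d i)%:R) /\ (\sum_i d i = 2 * e)%N.
Proof.
move=> [_ M0 Mint Msum].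
have rowE i : \sum_j M i j = (Num.truncn (\sum_j M i j))%:R.
  by apply/esym/truncnK; rewrite natrEint Mint sumr_ge0.
exists (fun i => Num.truncn (\sum_j M i j)); split=> //.
apply/eqP; rewrite -(eqr_nat R) natr_sum -Msum; apply/eqP.
by apply: eq_bigr => i _; rewrite -rowE.
Qed.

(** An upper vertex has a upper and b lower neighbours, a lower vertex has c
    upper and d lower ones. *)
Lemma graph_exists n q r e a b c d : (0 < r < n)%N -> (2 * e = n * q + r)%N ->
  (a + b = q.+1)%N -> (c + d = q)%N -> (a < r)%N -> (b <= n - r)%N -> (d < n - r)%N ->
  (r * b = (n - r) * c)%N -> ~~ odd (r * a) -> ~~ odd ((n - r) * d) ->
  exists g : rel 'I_n, [/\ simple_graph g, #|edges g| = e,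
    forall i, degree g i = (q + (i < r))%N
    & forall i, (\sum_(j < n | (j < r)%N) g i j = if (i < r)%N then a else c)%N].
Proof.
move=> /andP [r0 rn] edge_count.
have [s nE] : exists s, n = (r + s)%N by exists (n - r)%N; lia.
subst n; rewrite addKn => ab cd ar bs ds bip even_a even_d.
pose g := @two_part_graph r s a b d.
have g_simple : simple_graph g.
  by split; [exact: two_part_graph_sym | exact: two_part_graph_irr].
have inner i : (\sum_(j < r + s | (j < r)%N) g i j = if (i < r)%N then a else c)%N.
  case: ifP => [ir|/negbT ir]; first exact: two_part_graph_upper_upper.
  by apply: two_part_graph_lower_upper => //; lia.
have deg i : degree g i = (q + (i < r))%N.
  rewrite /degree (bigID (fun j : 'I_(r + s) => (j < r)%N)) /= inner.
  case: ifP => [ir|/negbT ir].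
    by rewrite two_part_graph_upper_lower //; lia.
  by rewrite two_part_graph_lower_lower //; lia.
exists g; split=> //.
have := handshake g_simple; rewrite (eq_bigr _ (fun i _ => deg i)).
rewrite big_split /= sum_nat_const card_ord sum_ltn; lia.
Qed.

Variables (n q r e : nat).
Hypothesis r_bounds : (0 < r < n)%N.
Hypothesis edge_count : (2 * e = n * q + r)%N.

Let n_gt0 : (0 < n)%N.
Proof. by lia. Qed.

(** Adjacency matrices have integral row sums, so a lower bound that is attained
    by some matrix is the common minimum iff some graph reaches it. *)
Let agreeE rho :
  (forall M, integral_row_matrices R n e M -> rho <= spectral_radius M) ->
  (exists2 M, integral_row_matrices R n e M & spectral_radius M <= rho) ->
  min_spectral_radii_agree R n e <->
  exists g : rel 'I_n, [/\ simple_graph g, #|edges g| = e &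
    spectral_radius (adjacency R g) <= rho].
Proof.
move=> lower [M Mint M_le]; split.
  move=> [r0 [[[_ [g [gs ge ->]] gr] _] [_ r0_le]]].
  exists g; split; [exact: gs | exact: ge |].
  by rewrite gr (le_trans (r0_le _ _) M_le) //; exists M.
move=> [g [gs ge g_le]].
have gint := adjacency_integral gs ge.
have gE : spectral_radius (adjacency R g) = rho.
  by apply/eqP; rewrite eq_le g_le (lower _ gint).
exists rho; split; split.
- by exists (adjacency R g); [exists g | exact: gE].
- by move=> _ [_ [h [hs he ->]] <-]; apply: lower; apply: adjacency_integral.
- by exists (adjacency R g); [exact: gint | exact: gE].
- by move=> _ [N Nint <-]; apply: lower.
Qed.

(** The equation for rho is the characteristic equation of the quotient matrix
    multiplied by n - r. *)
Lemma upper_balance (rho c : R) :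
  n%:R * rho * (rho - q%:R) = r%:R * (rho + (q.+1%:R - rho) ^+ 2) ->
  (n - r)%:R * c = r%:R * q.+1%:R ->
  c * q.+1%:R + (q%:R - c) * rho = rho ^+ 2.
Proof.
move=> rhoE cE.
have s0 : (n - r)%:R != 0 :> R by rewrite pnatr_eq0; lia.
apply: (mulfI s0); apply/eqP; rewrite -subr_eq0.
move: rhoE cE; rewrite natrB -?natr1; last by lia.
move=> rhoE cE; apply/eqP.
transitivity (((n%:R - r%:R) * c - r%:R * (q%:R + 1)) * (q%:R + 1 - rho) -
  (n%:R * rho * (rho - q%:R) - r%:R * (rho + (q%:R + 1 - rho) ^+ 2))); first by ring.
by rewrite cE rhoE !subrr mul0r subrr.
Qed.

(** The equation for rho is the characteristic equation of the quotient matrix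
    multiplied by r. *)
Lemma lower_balance (rho b : R) :
  n%:R * q%:R * (rho - q%:R) = r%:R * (q%:R + (q.+1%:R - rho) * (rho - q%:R)) ->
  r%:R * b = (n - r)%:R * q%:R ->
  (q.+1%:R - b) * rho + b * q%:R = rho ^+ 2.
Proof.
move=> rhoE bE.
have s0 : r%:R != 0 :> R by rewrite pnatr_eq0; lia.
apply: (mulfI s0); apply/eqP; rewrite -subr_eq0.
move: rhoE bE; rewrite natrB -?natr1; last by lia.
move=> rhoE bE; apply/eqP.
transitivity ((r%:R * b - (n%:R - r%:R) * q%:R) * (q%:R - rho) -
  (n%:R * q%:R * (rho - q%:R) -
   r%:R * (q%:R + (q%:R + 1 - rho) * (rho - q%:R)))); first by ring.
by rewrite bE rhoE !subrr mul0r subrr.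
Qed.

(** The regime is the one where c = r(q+1)/(n-r) is at most q, so that q - c can
    be a row sum of the block matrix and a degree in the graph. *)
Lemma agree_upper : (r * (2 * q + 1) <= q * n)%N ->
  min_spectral_radii_agree R n e <->
  ((n - r %| r * q.+1) && (q.+1 <= n - r))%N.
Proof.
move=> regime; have [rho [rho_bounds rhoE]] := upper_level_root R q r_bounds.
have [r_gt0 r_lt] := andP r_bounds.
have rho_gt0 : 0 < rho by case/andP: rho_bounds => lo _; apply: le_lt_trans lo.
have s_gt0 : 0 < (n - r)%:R :> R by rewrite ltr0n; lia.
have [rho_lo rho_hi] := andP rho_bounds.
rewrite (@agreeE rho); first last.
- pose c : R := r%:R * q.+1%:R / (n - r)%:R.
  have cE : (n - r)%:R * c = r%:R * q.+1%:R by rewrite mulrC divfK // gt_eqF.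
  have c_le : c <= q%:R.
    rewrite ler_pdivrMr // -!natrM ler_nat; lia.
  pose M := @two_block_mx R n r 0 (q.+1%:R / (n - r)%:R) ((q%:R - c) / (n - r)%:R).
  have row1 : r%:R * 0 + (n - r)%:R * (q.+1%:R / (n - r)%:R) = q.+1%:R :> R.
    by rewrite mulr0 add0r mulrC divfK // gt_eqF.
  have row2 : r%:R * (q.+1%:R / (n - r)%:R) + (n - r)%:R * ((q%:R - c) / (n - r)%:R) = q%:R :> R.
    by rewrite /c; field; rewrite gt_eqF.
  have b0 : 0 <= q.+1%:R / (n - r)%:R :> R by rewrite divr_ge0 ?ler0n.
  have g0 : 0 <= (q%:R - c) / (n - r)%:R by rewrite divr_ge0 ?subr_ge0 // ltW.
  exists M; first by apply: two_block_mx_integral edge_count _ _ _ row1 row2; rewrite // ltnW.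
  apply: (@upper_level_radius_le _ _ M (fun i => (i < r)%N) q rho n_gt0 _ _ _ c) => //.
  + exact: two_block_mx_ge0.
  + exact: two_block_mx_sym.
  + by move=> i; apply: two_block_mx_row row1 row2 _; rewrite ltnW.
  + move=> i; rewrite two_block_mx_row_upper ?(ltnW r_lt) // mulr0.
    by case: ifP => // _; rewrite /c mulrA.
  + exact: upper_balance.
- move=> M Mint; have [d [Md sum_d]] := integral_degrees Mint.
  have [MT M0 _ _] := Mint.
  by have [] := upper_level_independent n_gt0 M0 MT Md (etrans sum_d edge_count) r_gt0 rho_bounds rhoE.
split.
  move=> [g [gs ge g_le]].
  have sum_d : (\sum_i degree g i = n * q + r)%N by rewrite handshake // ge edge_count.
  have [_ /(_ g_le) [deg indep eig]] := upper_level_independent n_gt0 (adjacency_ge0 g)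
    (adjacency_sym gs) (adjacency_row g) sum_d r_gt0 rho_bounds rhoE.
  (* The eigenvector equation fixes the number of upper neighbours of a lower vertex. *)
  have eigB i : ~~ (q < degree g i)%N ->
      (q.+1%:R - rho) * (\sum_(j | q < degree g j) g i j)%N%:R = rho ^+ 2 - rho * q%:R.
    move=> Bi; have := eig i; rewrite (negPf Bi) mulr0 addr0.
    have -> : \sum_j adjacency R g i j * (rho + (q.+1%:R - rho) * (q < degree g j)%N%:R) =
       rho * (degree g i)%:R + (q.+1%:R - rho) * (\sum_(j | q < degree g j) g i j)%N%:R.
      rewrite -adjacency_row -adjacency_row_in !mulr_sumr -big_split /=.
      by apply: eq_bigr => j _; ring.
    by rewrite deg (negPf Bi) addn0 -expr2 => <-; ring.
  pose c := if [pick i | ~~ (q < degree g i)%N] is Some i then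
    (\sum_(j | q < degree g j) g i j)%N else 0%N.
  apply: (@upper_structure_arith _ g gs q r deg sum_d r_bounds c).
    move=> i j Ai Aj; have := indep i j Ai Aj; rewrite mxE => /eqP.
    by rewrite pnatr_eq0 eqb0.
  move=> i Bi; rewrite /c; case: pickP => [i0 /= Bi0|/(_ i)]; last by rewrite Bi.
  apply/eqP; rewrite -(eqr_nat R); apply/eqP.
  have h0 : q.+1%:R - rho != 0 by rewrite subr_eq0 gt_eqF.
  by apply: (mulfI h0); rewrite !eigB.
move=> /andP [/dvdnP [c cE] q_lt].
have c_le_q : (c <= q)%N by rewrite -(leq_pmul2r (_ : 0 < n - r)%N) -?cE; lia.
have [||||||||g [gs ge deg inner]] := @graph_exists n q r e 0 q.+1 c (q - c) r_bounds edge_count.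
all: rewrite ?muln0 //; try lia.
exists g; split=> //.
apply: (@upper_level_radius_le _ _ (adjacency R g) (fun i => (i < r)%N) q rho n_gt0 _ _ _ c%:R) => //.
- exact: adjacency_ge0.
- exact: adjacency_sym.
- by move=> i; rewrite adjacency_row deg.
- by move=> i; rewrite (adjacency_row_in g (fun j => (j < r)%N)) inner; case: ifP.
- by apply: upper_balance => //; rewrite -!natrM cE mulnC.
Qed.

(** The regime is the one where b = (n-r)q/r is less than q+1, so that q + 1 - b
    can be a row sum of the block matrix and a degree in the graph. *)
Lemma agree_lower : (q * n < r * (2 * q + 1))%N ->
  min_spectral_radii_agree R n e <->
  [&& r %| (n - r) * q, q <= r & q.+2 <= r + (n - r) * q %/ r]%N.
Proof.
move=> regime; have [rho [rho_bounds rhoE]] := lower_level_root R q r_bounds.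
have [r_gt0 r_lt] := andP r_bounds.
have rho_gt0 : 0 < rho by case/andP: rho_bounds => lo _; apply: le_lt_trans lo.
have s_gt0 : 0 < (n - r)%:R :> R by rewrite ltr0n; lia.
have rR_gt0 : 0 < r%:R :> R by rewrite ltr0n.
have [rho_lo rho_hi] := andP rho_bounds.
have rho_ge1 : 1 <= rho.
  have [q0|q_gt0] := posnP q; last by apply: ltW; apply: le_lt_trans rho_lo; rewrite ler1n.
  move: rhoE; rewrite q0 mulr0 mul0r add0r subr0 => /esym/eqP.
  by rewrite !mulf_eq0 (gt_eqF rR_gt0) (gt_eqF rho_gt0) orbF subr_eq0 => /eqP <-.
rewrite (@agreeE rho); first last.
- pose b : R := (n - r)%:R * q%:R / r%:R.
  have bE : r%:R * b = (n - r)%:R * q%:R by rewrite mulrC divfK // gt_eqF.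
  have b_le : b <= q.+1%:R.
    rewrite ler_pdivrMr // -!natrM ler_nat; lia.
  pose M := @two_block_mx R n r ((q.+1%:R - b) / r%:R) (q%:R / r%:R) 0.
  have row1 : r%:R * ((q.+1%:R - b) / r%:R) + (n - r)%:R * (q%:R / r%:R) = q.+1%:R :> R.
    by rewrite /b; field; rewrite gt_eqF.
  have row2 : r%:R * (q%:R / r%:R) + (n - r)%:R * 0 = q%:R :> R.
    by rewrite mulr0 addr0 mulrC divfK // gt_eqF.
  have b0 : 0 <= q%:R / r%:R :> R by rewrite divr_ge0 ?ler0n.
  have a0 : 0 <= (q.+1%:R - b) / r%:R by rewrite divr_ge0 ?subr_ge0 // ltW.
  exists M; first by apply: two_block_mx_integral edge_count _ _ _ row1 row2; rewrite // ltnW.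
  apply: (@lower_level_radius_le _ _ M (fun i => (i < r)%N) q rho n_gt0 _ _ _ b) => //.
  + exact: two_block_mx_ge0.
  + exact: two_block_mx_sym.
  + by move=> i; apply: two_block_mx_row row1 row2 _; rewrite ltnW.
  + move=> i; rewrite two_block_mx_row_upper ?(ltnW r_lt) //.
    by case: ifP => // _; rewrite mulrC divfK // gt_eqF.
  + exact: lower_balance.
- move=> M Mint; have [d [Md sum_d]] := integral_degrees Mint.
  have [MT M0 _ _] := Mint.
  by have [] := lower_level_independent n_gt0 M0 MT Md (etrans sum_d edge_count) r_gt0 rho_bounds rhoE.
split.
  move=> [g [gs ge g_le]].
  have sum_d : (\sum_i degree g i = n * q + r)%N by rewrite handshake // ge edge_count.
  have [_ /(_ g_le) [deg indep eig]] := lower_level_independent n_gt0 (adjacency_ge0 g)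
    (adjacency_sym gs) (adjacency_row g) sum_d r_gt0 rho_bounds rhoE.
  (* The eigenvector equation fixes the number of upper neighbours of an upper vertex. *)
  have eigA i : (q < degree g i)%N ->
      (rho - q%:R) * (\sum_(j | q < degree g j) g i j)%N%:R = rho ^+ 2 - q%:R * q.+1%:R.
    move=> Ai; have := eig i; rewrite Ai mulr1 [q%:R + _]addrC subrK.
    have -> : \sum_j adjacency R g i j * (q%:R + (rho - q%:R) * (q < degree g j)%N%:R) =
       q%:R * (degree g i)%:R + (rho - q%:R) * (\sum_(j | q < degree g j) g i j)%N%:R.
      rewrite -adjacency_row -adjacency_row_in !mulr_sumr -big_split /=.
      by apply: eq_bigr => j _; ring.
    by rewrite deg Ai addn1 -expr2 => <-; ring.
  pose c := if [pick i | (q < degree g i)%N] is Some i then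
    (\sum_(j | q < degree g j) g i j)%N else 0%N.
  apply: (@lower_structure_arith _ g gs q r deg sum_d r_bounds c).
    move=> i j; rewrite -!leqNgt => Ai Aj; have := indep i j Ai Aj; rewrite mxE => /eqP.
    by rewrite pnatr_eq0 eqb0.
  move=> i Bi; rewrite /c; case: pickP => [i0 /= Bi0|/(_ i)]; last by rewrite Bi.
  apply/eqP; rewrite -(eqr_nat R); apply/eqP.
  have h0 : rho - q%:R != 0 by rewrite subr_eq0 gt_eqF.
  by apply: (mulfI h0); rewrite !eigA.
move=> /and3P [/dvdnP [b bE] q_le].
rewrite bE mulnK // => b_ge.
have b_le_q : (b <= q)%N.
  suff : (b * r < q.+1 * r)%N by rewrite ltn_pmul2r.
  by rewrite -bE; lia.
have b_le_s : (b <= n - r)%N by rewrite -(leq_pmul2r r_gt0) -bE leq_pmul2l //; lia.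
have [||||||||g [gs ge deg inner]] := @graph_exists n q r e (q.+1 - b) b q 0 r_bounds edge_count.
all: rewrite ?muln0 ?addn0 //; try lia.
exists g; split=> //.
apply: (@lower_level_radius_le _ _ (adjacency R g) (fun i => (i < r)%N) q rho n_gt0 _ _ _ b%:R) => //.
- exact: adjacency_ge0.
- exact: adjacency_sym.
- by move=> i; rewrite adjacency_row deg.
- move=> i; rewrite (adjacency_row_in g (fun j => (j < r)%N)) inner; case: ifP => // _.
  by rewrite natrB //; lia.
- by apply: lower_balance => //; rewrite -!natrM bE mulnC.
Qed.

Lemma agree_attainable : min_spectral_radii_agree R n e <-> attainable n q r.
Proof.
rewrite /attainable; case: (leqP (r * (2 * q + 1)) (q * n)) => regime.
  exact: agree_upper.
exact: agree_lower.
Qed.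

End Agree.

(** * Counting the admissible pairs (q, r) *)

Section Counting.
Local Open Scope nat_scope.

(** Once the gcd g is split off, the divisibility conditions say q+1 = k s or
    q = k r, and the inequalities separating the two regimes reduce to r < s. *)
Lemma attainableE g r s q : 0 < g -> 0 < r -> 0 < s -> coprime r s ->
  attainable (g * (r + s)) q (g * r) =
  (q == 0) && (1 < g * r) ||
  (if r < s then (s %| q.+1) && (q.+1 <= g * s)
   else [&& 1 < g * s, r %| q, 0 < q & q <= g * r]).
Proof.
move=> g0 r0 s0 co.
rewrite /attainable -mulnBr addKn.
have -> : (g * r * (2 * q + 1) <= q * (g * (r + s))) = (r * q.+1 <= q * s).
  by rewrite -[RHS](leq_pmul2l g0); apply/idP/idP; lia.
have -> : (g * s %| g * r * q.+1) = (s %| q.+1).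
  by rewrite -mulnA dvdn_pmul2l // Gauss_dvdr // coprime_sym.
rewrite -(mulnA g s q) dvdn_pmul2l // (Gauss_dvdr _ co) (divnMl g0).
case: (leqP (r * q.+1) (q * s)) => regime.
  have q_gt0 : 0 < q by case: (q) regime => //; lia.
  have rs : r < s by nia.
  by rewrite rs (gtn_eqF q_gt0).
case: (posnP q) => [q_eq0|q_gt0] /=.
  rewrite q_eq0 dvdn0 muln0 div0n addn0 /= !andbF.
  case: ifP => rs; rewrite ?orbF // dvdn1; apply/idP/idP => [->//|].
  by case/orP => [//|/andP[/eqP s1 _]]; lia.
case: ifP => rs /=.
  apply/and3P/andP => [[/dvdnP [k kE] _ _]|[/dvdnP [k kE] _]].
    have : k * s < k * r + 1 by rewrite -(ltn_pmul2l r0); rewrite kE in regime; lia.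
    by have : k * r.+1 <= k * s := leq_mul (leqnn k) rs; case: (k) kE => [|k']; lia.
  have : q < r * k by rewrite -(ltn_pmul2r s0) -mulnA -kE.
  by have : k * r.+1 <= k * s := leq_mul (leqnn k) rs; case: (k) kE => [|k']; lia.
have [/dvdnP [k kE]|] := boolP (r %| q); last by rewrite andbF.
rewrite kE mulnCA mulnA mulnK // in q_gt0 regime *.
rewrite !leq_pmul2r // /=.
have [le_kg|] := leqP k g; rewrite ?andbF //= andbT.
have k_gt0 : 0 < k by case: (k) q_gt0.
have [m gE] : exists m, g = k + m by exists (g - k); lia.
rewrite gE !mulnDl.
have : m * s <= m * r by rewrite leq_mul2l; lia.
have : 0 < k * s by rewrite muln_gt0 k_gt0.
case: (posnP m) => [->|m_gt0]; first by rewrite !mul0n addn0; lia.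
have : 0 < m * s by rewrite muln_gt0 m_gt0.
by lia.
Qed.

Lemma count_multiples s g Q (P : pred nat) : 0 < s -> g * s <= Q ->
  \sum_(q < Q) [&& s %| q.+1, q < g * s & P q] = \sum_(k < g) P (k.+1 * s).-1.
Proof.
move=> s_gt0 le_Q.
have [Q' ->] : exists Q', Q = g * s + Q' by exists (Q - g * s); lia.
rewrite big_split_ord /= [X in _ + X]big1 ?addn0; last first.
  by move=> q _; rewrite [_ + q < _]ltnNge leq_addr andbF.
rewrite -(sum_blocks g s (fun q => [&& s %| q.+1, q < g * s & P q])).
apply: eq_bigr => k _; have kg := ltn_ord k.
have lt_s : s.-1 < s by lia.
rewrite (bigD1 (Ordinal lt_s)) //= big1 ?addn0.
  have -> : k * s + s.-1 = (k.+1 * s).-1 by lia.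
  have pos : 0 < k.+1 * s by rewrite muln_gt0.
  by rewrite (prednK pos) dvdn_mull //= leq_mul2r kg orbT.
move=> t t_neq; have ts := ltn_ord t; apply/eqP; rewrite eqb0.
apply: contraNN t_neq => /and3P [dv _ _]; apply/eqP/val_inj => /=.
move: dv; rewrite -addnS dvdn_addr ?dvdn_mull // => /dvdn_leq -/(_ isT); lia.
Qed.

(** The bound Q is there to make the count finite: for 0 < r < n, only values
    of q below n are attainable. *)
Definition level_count Q n r := \sum_(q < Q) (~~ odd (n * q + r) && attainable n q r).

(** The multiplier of s or r is k + 1, as k runs from 0. *)
Lemma level_countE g r s Q : 0 < g -> 0 < r -> 0 < s -> coprime r s ->
  g * (r + s) < Q ->
  level_count Q (g * (r + s)) (g * r) =
  (~~ odd (g * r) && (1 < g * r)) +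
  if r < s then \sum_(k < g) ~~ odd (g * (r + s) * (k.+1 * s).-1 + g * r)
  else if 1 < g * s then \sum_(k < g) ~~ odd (g * (r + s) * (k.+1 * r) + g * r)
  else 0.
Proof.
move=> g0 r0 s0 co ltQ; rewrite /level_count; set n := g * (r + s).
under eq_bigr => q _ do rewrite attainableE //.
case: Q ltQ => // Q; rewrite ltnS mulnDr => le_Q.
case: ifP => rs.
  rewrite -(count_multiples (Q := Q.+1) (fun q => ~~ odd (n * q + g * r))) //; last by lia.
  rewrite !big_ord_recl /= muln0 add0n.
  have -> : s %| 1 = false by rewrite dvdn1; lia.
  rewrite orbF add0n; congr (_ + _); apply: eq_bigr => q _.
  by rewrite /bump /= add1n andbC andbA.
rewrite big_ord_recl /= muln0 add0n !andbF orbF; congr (_ + _).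
case: ifP => gs; last by rewrite big1 // => q _; rewrite andbF.
transitivity (\sum_(q < Q) [&& r %| q.+1, q < g * r & ~~ odd (n * q.+1 + g * r)]).
  by apply: eq_bigr => q _; rewrite /bump /= add1n andbC andbA.
rewrite (@count_multiples r g Q (fun q => ~~ odd (n * q.+1 + g * r)) r0); last by lia.
apply: eq_bigr => k _; have pos : 0 < k.+1 * r by rewrite muln_gt0.
by rewrite (prednK pos).
Qed.

Lemma gcd_split n r : 0 < r < n -> exists r' s',
  [/\ 0 < r', 0 < s', coprime r' s', r = gcdn n r * r' & n = gcdn n r * (r' + s')].
Proof.
move=> /andP [r_gt0 r_lt].
have g_gt0 : 0 < gcdn n r by rewrite gcdn_gt0 r_gt0 orbT.
have /dvdnP [r' rE] := dvdn_gcdr n r.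
have /dvdnP [n' nE] := dvdn_gcdl n r.
have lt_rn : r' < n' by rewrite -(ltn_pmul2r g_gt0) -rE -nE.
have co : coprime r' n'.
  rewrite /coprime -(eqn_pmul2r g_gt0) mul1n muln_gcdl -rE -nE gcdnC.
  exact: eqxx.
exists r', (n' - r'); split.
- by rewrite -(ltn_pmul2r g_gt0) mul0n -rE.
- by rewrite subn_gt0.
- by rewrite /coprime -gcdnDl (subnKC (ltnW lt_rn)).
- exact: (etrans rE (mulnC _ _)).
- rewrite (subnKC (ltnW lt_rn)); exact: (etrans nE (mulnC _ _)).
Qed.

Lemma sum_bool_le g (P : pred nat) : \sum_(k < g) P k <= g.
Proof.
elim: g => [|g IHg]; first by rewrite big_ord0.
by rewrite big_ord_recr /= -[g.+1]addn1; apply: leq_add IHg (leq_b1 _).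
Qed.

Lemma sum_bool_gt0 g (P : pred nat) : 0 < g -> P 0 -> 0 < \sum_(k < g) P k.
Proof. by case: g => // g _ P0; rewrite big_ord_recl P0. Qed.

Lemma sum_bool_gt1 g (P : pred nat) : 2 < g -> P 0 -> P 2 -> 1 < \sum_(k < g) P k.
Proof.
by case: g => [|[|[|g]]] // _ P0 P2; rewrite !big_ord_recl P0 /= P2; lia.
Qed.

Lemma level_count_even n r Q : ~~ odd n -> ~~ odd r -> 0 < r < n -> n < Q ->
  level_count Q n r = 1 + gcdn n r.
Proof.
move=> even_n even_r r_bounds ltQ.
have g_gt0 : 0 < gcdn n r by rewrite gcdn_gt0 (andP r_bounds).1 orbT.
have [r' [s' []]] := gcd_split r_bounds.
move: (gcdn n r) g_gt0 => g g_gt0 r_gt0 s_gt0 co rE nE; subst n; rewrite {}rE in even_r r_bounds *.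
rewrite level_countE // even_r /=; congr (_ + _); first by lia.
have even_all q : ~~ odd (g * (r' + s') * q + g * r').
  by rewrite oddD oddM (negPf even_n) (negPf even_r).
have gs : 1 < g * s' by lia.
by rewrite gs; case: ifP => _; under eq_bigr => k _ do rewrite even_all;
  rewrite sum_nat_const card_ord muln1.
Qed.

Lemma level_count_even_odd n r Q : ~~ odd n -> odd r -> level_count Q n r = 0.
Proof.
move=> even_n odd_r; rewrite /level_count big1 // => q _.
by rewrite oddD oddM (negPf even_n) odd_r.
Qed.

(** The parity condition holds for all odd multipliers.  Since g is odd, there
    is room for the multipliers 1 and 3 as soon as g > 1. *)
Lemma level_count_odd n r Q : odd n -> 0 < r < n -> n < Q ->
  exists c, [/\ level_count Q n r = ~~ odd r + c, c <= gcdn n r,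
    r.+1 < n -> 0 < c, r.+1 < n -> 1 < gcdn n r -> 1 < c & r.+1 = n -> c = 0].
Proof.
move=> odd_n r_bounds ltQ.
have g_gt0 : 0 < gcdn n r by rewrite gcdn_gt0 (andP r_bounds).1 orbT.
have [r' [s' []]] := gcd_split r_bounds.
move: (gcdn n r) g_gt0 => g g_gt0 r_gt0 s_gt0 co rE nE; subst n; rewrite {}rE in r_bounds *.
have odd_g : odd g by move: odd_n; rewrite oddM => /andP [].
rewrite level_countE //.
have -> : ~~ odd (g * r') && (1 < g * r') = ~~ odd (g * r').
  by case: (boolP (odd (g * r'))) => //= ?; lia.
have [n nE] : exists n, n = g * (r' + s') by eexists.
rewrite -nE in odd_n r_bounds *.
have odd_rs : odd (r' + s') by move: odd_n; rewrite nE oddM => /andP [].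
have upper_par k : ~~ odd k -> ~~ odd (n * (k.+1 * s').-1 + g * r').
  have -> : n * (k.+1 * s').-1 + g * r' = s' * (k * n + g * (r' + s'.-1)).
    have -> : (k.+1 * s').-1 = k * s' + s'.-1 by lia.
    by rewrite nE; case: (s') s_gt0 => // s0 _ /=; lia.
  move: odd_rs; rewrite !(oddM, oddD) odd_n odd_g; case: (s') s_gt0 => //= s0 _.
  by case: (odd k); case: (odd r'); case: (odd s0).
have lower_par k : ~~ odd k -> ~~ odd (n * (k.+1 * r') + g * r').
  by rewrite !(oddM, oddD) odd_n odd_g /=; case: (odd k); case: (odd r').
exists (if r' < s' then \sum_(k < g) ~~ odd (n * (k.+1 * s').-1 + g * r')
  else if 1 < g * s' then \sum_(k < g) ~~ odd (n * (k.+1 * r') + g * r') else 0).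
have sE : n = g * r' + g * s' by rewrite -mulnDr.
split=> //.
- case: ifP => rs; first exact: (sum_bool_le g (fun k => ~~ odd (n * (k.+1 * s').-1 + g * r'))).
  case: ifP => gs //; exact: (sum_bool_le g (fun k => ~~ odd (n * (k.+1 * r') + g * r'))).
- move=> lt_rn; have -> : 1 < g * s' by lia.
  case: ifP => rs.
    by apply: (sum_bool_gt0 (P := fun k => ~~ odd (n * (k.+1 * s').-1 + g * r'))) => //; apply: upper_par.
  by apply: (sum_bool_gt0 (P := fun k => ~~ odd (n * (k.+1 * r') + g * r'))) => //; apply: lower_par.
- move=> lt_rn g_gt1; have -> : 1 < g * s' by lia.
  have g_gt2 : 2 < g by case: (g) odd_g g_gt1 => [|[|[|]]].
  case: ifP => rs.
    by apply: (sum_bool_gt1 (P := fun k => ~~ odd (n * (k.+1 * s').-1 + g * r'))) => //; apply: upper_par.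
  by apply: (sum_bool_gt1 (P := fun k => ~~ odd (n * (k.+1 * r') + g * r'))) => //; apply: lower_par.
- move=> rn; have gs : g * s' = 1 by lia.
  have s1 : s' = 1 by move/eqP: gs; rewrite muln_eq1 => /andP [_ /eqP].
  by rewrite gs s1 ltnn; case: ifP => //; lia.
Qed.

Definition total_count n := \sum_(r < n | 0 < r) level_count (2 * n) n r.

Lemma coprime_below_prime n : 1 < n ->
  [forall (r : 'I_n | 0 < r), gcdn n r == 1] = prime n.
Proof.
move=> n_gt1; apply/forall_inP/idP => [co|n_prime r r_gt0].
  apply/negPn/negP => n_comp.
  have lt_pn : pdiv n < n.
    rewrite ltn_neqAle pdiv_leq ?(ltnW n_gt1) // andbT.
    by apply: contraNneq n_comp => <-; apply: pdiv_prime.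
  have := co (Ordinal lt_pn) (pdiv_gt0 n).
  rewrite /= (gcdn_idPr (pdiv_dvd n)) => /eqP p1.
  by have := pdiv_prime n_gt1; rewrite p1.
rewrite -/(coprime n r) prime_coprime // gtnNdvd //.
Qed.

Lemma total_count_even N : 0 < N ->
  total_count (N * 2) = \sum_(s < N | 0 < s) (1 + 2 * gcdn N s).
Proof.
move=> N_gt0; set n := N * 2.
pose G r := if 0 < r then level_count (2 * n) n r else 0.
have -> : total_count n = \sum_(r < N * 2) G r.
  by rewrite /total_count big_mkcond.
rewrite -(sum_blocks N 2 G) [RHS]big_mkcond; apply: eq_bigr => s _.
rewrite !big_ord_recl big_ord0 /= addn0 addn0.
have -> : G (s * 2 + 1) = 0.
  by rewrite /G; case: ifP => // _; apply: level_count_even_odd; rewrite /n; lia.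
rewrite addn0 /G muln_gt0 andbT; case: ifP => // s_gt0; have := ltn_ord s => sN.
rewrite level_count_even /n; [|lia|lia|lia|lia].
by rewrite -muln_gcdl mulnC.
Qed.

Lemma sum_even_below m : \sum_(r < (2 * m).+1 | 0 < r) ~~ odd r = m.
Proof.
rewrite big_mkcond /=; elim: m => [|m IHm]; first by rewrite big_ord_recl big_ord0.
by rewrite mulnS !add2n big_ord_recr big_ord_recr /= IHm; lia.
Qed.

(** For odd n, the count for r is compared with [r even] + [r < n-1]; for even n,
    the term 1 + 2 gcd(n/2, s) is compared with 3. *)
Lemma total_count_bound n : 3 <= n -> (3 * n - 5) %/ 2 <= total_count n ?= iff
  prime n || ~~ odd n && prime n./2.
Proof.
move=> n_ge3; have [odd_n|even_n] := boolP (odd n) => /=.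
  rewrite orbF; pose base r := ~~ odd r + (r.+1 < n).
  have baseE : \sum_(r < n | 0 < r) base r = (3 * n - 5) %/ 2.
    rewrite big_split /=.
    have nE : (2 * n./2).+1 = n by lia.
    have := sum_even_below n./2; rewrite nE => ->.
    have -> : \sum_(r < n | 0 < r) (r.+1 < n) = n - 2.
      case: (n) n_ge3 => // k k_ge; rewrite big_mkcond big_ord_recl /= add0n.
      under eq_bigr => i _ do rewrite /bump /= add1n ltnS.
      have -> : \sum_(i < k) (i.+1 < k) = \sum_(i < k) (i < k.-1) by apply: eq_bigr => i _; lia.
      by rewrite sum_ltn; lia.
    by lia.
  rewrite -baseE -(coprime_below_prime (ltnW n_ge3)); apply: leqif_sum => r r_gt0.
  have r_lt := ltn_ord r.
  have [||c [-> c_le c_ge1 c_ge2 c_eq0]] := @level_count_odd n r (2 * n) odd_n; [lia|lia|].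
  rewrite /base; apply/leqifP; have [rn|rn] := ltnP r.+1 n.
    have := c_ge1 rn; have := c_ge2 rn; move: (gcdn n r) c_le => g c_le c_gt1 c_gt0.
    by rewrite eqn_add2l ltn_add2l /=; case: eqP => g1; lia.
  have rE : r.+1 = n by lia.
  rewrite c_eq0 // -[X in gcdn X _]rE.
  by rewrite -/(coprime _ _) coprimeSn eqxx.
have n2 : n = n./2 * 2 by lia.
have N_gt1 : 1 < n./2 by lia.
have -> : prime n = false.
  apply/negbTE/negP => n_prime; case: (even_prime n_prime) => [n_eq2|odd_n].
    by rewrite n_eq2 in n_ge3.
  by rewrite odd_n in even_n.
rewrite {2}n2 total_count_even ?(ltnW N_gt1) // -(coprime_below_prime N_gt1).
have -> : (3 * n - 5) %/ 2 = \sum_(s < n./2 | 0 < s) 3.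
  rewrite big_mkcond /=; case: (n./2) n2 N_gt1 => // N n2 _.
  by rewrite big_ord_recl /= sum_nat_const card_ord; lia.
apply: leqif_sum => s s_gt0; apply/leqifP.
have : 0 < gcdn n./2 s by rewrite gcdn_gt0 s_gt0 orbT.
by move: (gcdn _ _) => g g_gt0; case: eqP => g1; lia.
Qed.

End Counting.

(** * From pairs to edge counts *)

Section EdgeCounts.
Local Open Scope nat_scope.

Definition good_edge_count n e :=
  (0 < (2 * e) %% n) && attainable n ((2 * e) %/ n) ((2 * e) %% n).

Lemma agreeing_edge_countsP (R : realType) n e : 0 < n ->
  agreeing_edge_counts R n e <-> good_edge_count n e.
Proof.
move=> n_gt0; rewrite /agreeing_edge_counts /good_edge_count /= /dvdn -lt0n.
have mod_lt : (2 * e) %% n < n by rewrite ltn_mod.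
have edge_count : 2 * e = n * ((2 * e) %/ n) + (2 * e) %% n by rewrite [n * _]mulnC -divn_eq.
split=> [[r_gt0 agree]|/andP [r_gt0 att]].
  rewrite r_gt0; apply/(agree_attainable R _ edge_count) => //.
  by rewrite r_gt0.
split=> //; apply/(agree_attainable R _ edge_count) => //.
by rewrite r_gt0.
Qed.

Lemma good_edge_count_lt n e : 0 < n -> good_edge_count n e -> e < n * n.
Proof.
move=> n_gt0 /andP [r_gt0 att].
have mod_lt : (2 * e) %% n < n by rewrite ltn_mod.
have q_lt : (2 * e) %/ n < n.
  by move: att; rewrite /attainable; case: ifP => _; [case/andP | case/and3P]; lia.
have : ((2 * e) %/ n).+1 * n <= n * n by rewrite leq_mul2r q_lt orbT.
have := divn_eq (2 * e) n; lia.
Qed.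

(** The values 2e are the even numbers nq + r below 2n^2. *)
Lemma sum_good_edge_count n : 0 < n ->
  \sum_(e < n * n) good_edge_count n e = total_count n.
Proof.
move=> n_gt0.
pose H m := [&& 0 < m %% n, ~~ odd m & attainable n (m %/ n) (m %% n)].
transitivity (\sum_(m < n * n * 2) H m).
  rewrite -(sum_blocks (n * n) 2 H); apply: eq_bigr => e _.
  rewrite !big_ord_recl big_ord0 /= !addn0 /H /good_edge_count [e * 2]mulnC.
  rewrite oddD oddM /= andbF addn0.
  by [].
have -> : n * n * 2 = 2 * n * n by lia.
rewrite -(sum_blocks (2 * n) n H) exchange_big /= /total_count [RHS]big_mkcond /=.
apply: eq_bigr => r _; case: ifP => r_gt0; last first.
  by rewrite big1 // => q _; rewrite /H modnMDl modn_small // r_gt0.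
apply: eq_bigr => q _.
by rewrite /H modnMDl modn_small // divnMDl // divn_small // addn0 r_gt0 [q * n]mulnC.
Qed.

Lemma E_total_count (R : realType) n : 0 < n -> E R n = total_count n.
Proof.
move=> n_gt0; rewrite -sum_good_edge_count // /E.
pose L := [seq e <- iota 0 (n * n) | good_edge_count n e].
have -> : agreeing_edge_counts R n = [set` [fset e in L]%fset].
  apply/seteqP; split => e /=.
    move/(agreeing_edge_countsP R e n_gt0) => good_e.
    by rewrite inE mem_filter good_e mem_iota good_edge_count_lt.
  by rewrite inE mem_filter => /andP [good_e _]; apply/(agreeing_edge_countsP R e n_gt0).
rewrite set_fsetK card_fseq undup_id ?filter_uniq ?iota_uniq //.
by rewrite size_filter -sumn_count sumnE big_map -(big_mkord xpredT (fun e => nat_of_bool (good_edge_count n e))) /index_iota subn0.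
Qed.

End EdgeCounts.

(** * Integers with many divisors *)

Section HighlyComposite.
Local Open Scope nat_scope.

Definition gcd_sum n := \sum_(s < n) gcdn n s.

Lemma gcd_sumE n : 0 < n -> gcd_sum n = n + \sum_(s < n | 0 < s) gcdn n s.
Proof.
case: n => // n _; rewrite /gcd_sum [in RHS]big_mkcond !big_ord_recl /= gcdn0.
by rewrite add0n.
Qed.

(** As a function of s, gcd(M, s) has period M, so over p periods it sums to
    p [gcd_sum M].  For s = p t, gcd(M p, s) exceeds gcd(M, s) = gcd(M, t) by
    (p-1) gcd(M, t), and t runs through one period. *)
Lemma gcd_sum_mul_prime M p : prime p -> ~~ (p %| M) ->
  gcd_sum (M * p) = (2 * p).-1 * gcd_sum M.
Proof.
move=> p_prime p_ndvd; have p_gt0 := prime_gt0 p_prime.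
have co : coprime M p by rewrite coprime_sym prime_coprime.
pose G s := gcdn M s + (p %| s) * (p.-1 * gcdn M s).
have gcdE s : gcdn (M * p) s = G s.
  rewrite /G; have [/dvdnP [t ->]|p_nds] := boolP (p %| s).
    rewrite -muln_gcdl Gauss_gcdl // mul1n mulnC.
    by rewrite -[X in X + _]mul1n -mulnDl add1n prednK.
  by rewrite mul0n addn0 gcdnC Gauss_gcdl 1?gcdnC // coprime_sym prime_coprime.
rewrite /gcd_sum; under eq_bigr => s _ do rewrite gcdE.
rewrite big_split /=.
have -> : \sum_(s < M * p) gcdn M s = p * gcd_sum M.
  rewrite mulnC -(sum_blocks p M (gcdn M)).
  rewrite (eq_bigr (fun=> gcd_sum M)) ?sum_nat_const ?card_ord // => i _.
  by apply: eq_bigr => t _; rewrite gcdnMDl.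
rewrite -(sum_blocks M p (fun s => (p %| s) * (p.-1 * gcdn M s))).
have -> : \sum_(i < M) \sum_(t < p) (p %| i * p + t) * (p.-1 * gcdn M (i * p + t)) =
    p.-1 * gcd_sum M.
  rewrite /gcd_sum big_distrr; apply: eq_bigr => i _ /=.
  rewrite (bigD1 (Ordinal p_gt0)) //= addn0 dvdn_mull // mul1n Gauss_gcdl // big1 ?addn0 // => t t_neq.
  have p_nt : (p %| t) = false.
    rewrite gtnNdvd // lt0n; apply: contraNneq t_neq => t0.
    exact/eqP/val_inj.
  by rewrite dvdn_addr ?dvdn_mull // p_nt.
rewrite -mulnDl; congr (_ * _); lia.
Qed.

Definition prime_product (ps : seq nat) := \prod_(p <- ps) p.

Lemma prime_product_cons p ps : prime_product (p :: ps) = p * prime_product ps.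
Proof. exact: big_cons. Qed.

Lemma prime_dvd_product q ps : prime q -> all prime ps ->
  (q %| prime_product ps) = (q \in ps).
Proof.
move=> q_prime; rewrite /prime_product; elim: ps => [|p ps IHps] /=.
  by move=> _; rewrite big_nil dvdn1 in_nil; case: eqP q_prime => // ->.
move=> /andP [p_prime ps_prime].
by rewrite big_cons Euclid_dvdM // IHps // inE dvdn_prime2.
Qed.

Lemma prime_product_gt0 ps : all prime ps -> 0 < prime_product ps.
Proof.
rewrite /prime_product; elim: ps => [|p ps IHps] /=; first by rewrite big_nil.
by move=> /andP [p_prime /IHps IH]; rewrite big_cons muln_gt0 (prime_gt0 p_prime).
Qed.

Lemma prime_product_ge ps : all prime ps -> 2 ^ size ps <= prime_product ps.
Proof.
rewrite /prime_product; elim: ps => [|p ps IHps] /=; first by rewrite big_nil.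
by move=> /andP [p_prime /IHps]; rewrite big_cons expnS => ?; apply: leq_mul => //; apply: prime_gt1.
Qed.

(** Each prime contributes a factor (2p-1)/p, which is at least 3/2. *)
Lemma gcd_sum_product ps : uniq ps -> all prime ps ->
  prime_product ps * 3 ^ size ps <= gcd_sum (prime_product ps) * 2 ^ size ps.
Proof.
elim: ps => [|p ps IHps] /=.
  by rewrite /prime_product /gcd_sum big_nil big_ord_recl big_ord0.
move=> /andP [p_notin ps_uniq] /andP [p_prime ps_prime].
have := IHps ps_uniq ps_prime.
rewrite prime_product_cons [p * _]mulnC gcd_sum_mul_prime ?prime_dvd_product //.
have p_gt1 := prime_gt1 p_prime; rewrite !expnS => IH.
have p_le : p * 3 <= (2 * p).-1 * 2 by lia.
have := leq_mul p_le IH; move: (2 * p).-1 (3 ^ size ps) (2 ^ size ps) => c a b; lia.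
Qed.

(** A new prime p doubles the number of divisors: besides d there is p d. *)
Lemma divisors_product ps : uniq ps -> all prime ps ->
  2 ^ size ps <= size (divisors (prime_product ps)).
Proof.
elim: ps => [|p ps IHps] /=.
  by rewrite /prime_product big_nil.
move=> /andP [p_notin ps_uniq] /andP [p_prime ps_prime].
have M_gt0 := prime_product_gt0 ps_prime.
have p_ndvd : ~~ (p %| prime_product ps) by rewrite prime_dvd_product.
rewrite prime_product_cons; move: (prime_product ps) M_gt0 p_ndvd IHps => M M_gt0 p_ndvd IHps.
have p_gt0 := prime_gt0 p_prime.
have pM_gt0 : 0 < p * M by rewrite muln_gt0 p_gt0.
rewrite expnS mul2n -addnn.
apply: (@leq_trans (size (divisors M ++ [seq p * d | d <- divisors M]))).
  by rewrite size_cat size_map leq_add // IHps.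
apply: uniq_leq_size.
  rewrite cat_uniq divisors_uniq map_inj_uniq ?divisors_uniq ?andbT //=; last first.
    by move=> a b /eqP; rewrite eqn_pmul2l // => /eqP.
  apply/hasPn => _ /mapP [d _ ->]; rewrite -dvdn_divisors //.
  by apply: contra p_ndvd; apply: dvdn_trans; rewrite dvdn_mulr.
move=> d; rewrite mem_cat -!dvdn_divisors // => /orP [dM|/mapP [d' ]].
  by rewrite dvdn_mull.
by rewrite -dvdn_divisors // => d'M ->; rewrite dvdn_pmul2l.
Qed.

Lemma product_square_free ps d : uniq ps -> all prime ps ->
  d ^ 2 %| prime_product ps -> d = 1.
Proof.
move=> ps_uniq ps_prime d2; apply/eqP/negPn/negP => d_neq1.
have n_gt0 := prime_product_gt0 ps_prime.
have d_gt0 : 0 < d by case: (d) d2 n_gt0 => //; rewrite dvd0n => /eqP ->.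
have d_gt1 : 1 < d by lia.
pose q := pdiv d; have q_prime : prime q := pdiv_prime d_gt1.
have q2 : q * q %| prime_product ps.
  by apply: dvdn_trans d2; rewrite -mulnn dvdn_mul // pdiv_dvd.
have q_in : q \in ps.
  by rewrite -prime_dvd_product // (dvdn_trans _ q2) // dvdn_mulr.
move: q2; rewrite /prime_product (big_rem q) //= dvdn_pmul2l ?prime_gt0 //.
rewrite -/(prime_product _) prime_dvd_product //; last first.
  by apply/allP => p /mem_rem /(allP ps_prime).
by rewrite mem_rem_uniq // inE eqxx.
Qed.

(** This gives (3/2)^k - 1 >= (k+1)^2 / 16; with the constant 16 the induction
    can start at k = 1. *)
Lemma exp3_ge k : 0 < k -> (k.+1 ^ 2 + 16) * 2 ^ k <= 16 * 3 ^ k.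
Proof.
elim: k => // [[_ _|k IHk _]] //.
have := IHk isT; rewrite ![_ ^ k.+2]expnS.
set a := 2 ^ k.+1; set b := 3 ^ k.+1; move: a b => a b; nia.
Qed.

(** Raise k <= m (k/m + 1) <= m 2^(k/m) to the power m. *)
Lemma exp_bound m k : 0 < m -> k ^ m <= m ^ m * 2 ^ k.
Proof.
move=> m_gt0.
have k_le : k <= m * 2 ^ (k %/ m).
  apply: (@leq_trans (m * (k %/ m).+1)); first by have := divn_eq k m; have := ltn_pmod k m_gt0; lia.
  by rewrite leq_mul2l ltn_expl ?orbT.
have : k ^ m <= (m * 2 ^ (k %/ m)) ^ m by rewrite leq_exp2r.
move/leq_trans; apply; rewrite expnMn -expnM leq_mul2l leq_exp2l //.
by rewrite leq_trunc_div orbT.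
Qed.

(** In [exp_bound] with exponent 2j+1, the extra factor k absorbs the constants. *)
Lemma poly_le_exp j : exists K, forall k, K <= k -> (2 * k ^ 2) ^ j <= 2 ^ k.
Proof.
set m := (2 * j).+1; exists (2 ^ j * m ^ m) => k k_ge.
have m_pow_gt0 : 0 < m ^ m by rewrite expn_gt0.
rewrite -(leq_pmul2l m_pow_gt0); apply: leq_trans (exp_bound k (ltn0Sn _)).
rewrite expnMn -expnM mulnA expnS leq_mul2r; apply/orP; right.
by rewrite mulnC.
Qed.

Definition primes_upto n := [seq p <- iota 0 n.+1 | prime p].

Lemma primes_upto_prime n : all prime (primes_upto n).
Proof. exact: filter_all. Qed.

Lemma prod_primes_upto n m : 0 < m <= n ->
  \prod_(p <- primes_upto n) p ^ logn p m = m.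
Proof.
move=> /andP [m_gt0 m_le]; rewrite big_filter big_mkcond /=.
rewrite -[RHS](partnT m_gt0) (widen_partn _ m_le) /index_iota subn0 /=.
apply: eq_bigr => p _; case: ifP => // p_nprime.
by rewrite lognE p_nprime.
Qed.

(** Each positive m <= M^2 is determined by the set of primes that occur in it to
    an odd power, and by the square root (at most M) of the square that remains.
    With k primes up to M^2 this gives M^2 <= 2^k M. *)
Lemma prime_count_ge M : M <= 2 ^ size (primes_upto (M * M)).
Proof.
set n := M * M; set ps := primes_upto n; set k := size ps.
case: (posnP M) => [->//|M_gt0].
pose root (m : nat) := \prod_(p <- ps) p ^ (logn p m)./2.
pose bits (m : nat) : k.-tuple bool := [tuple of [seq odd (logn p m) | p <- in_tuple ps]].
have decomp m : 0 < m <= n ->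
    m = root m ^ 2 * \prod_(p <- ps) p ^ odd (logn p m).
  move=> m_bounds; rewrite -[LHS](prod_primes_upto m_bounds) /root.
  rewrite -mulnn -!big_split /=; apply: eq_bigr => p _.
  by rewrite -!expnD -{1}[logn p m]odd_double_half -addnn addnC.
have bitsE m : \prod_(p <- ps) p ^ odd (logn p m) =
    \prod_(pb <- zip ps (bits m)) pb.1 ^ pb.2.
  by rewrite /bits /=; elim: (ps) => [|p s IHs]; rewrite ?big_nil //= !big_cons IHs.
have root_le m : 0 < m <= n -> 0 < root m <= M.
  move=> m_bounds; have E := decomp m m_bounds.
  have [m_gt0 m_le] := andP m_bounds.
  have : 0 < root m ^ 2 * \prod_(p <- ps) p ^ odd (logn p m) by rewrite -E.
  rewrite muln_gt0 expn_gt0 orbF => /andP [-> b_gt0] /=.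
  rewrite -leq_sqr -mulnn -/n; apply: leq_trans m_le.
  by rewrite [X in _ <= X]E leq_pmulr.
have root_lt (i : 'I_n) : (root i.+1).-1 < M.
  by have := root_le i.+1 (ltn_ord i); lia.
pose f (i : 'I_n) : k.-tuple bool * 'I_M := (bits i.+1, Ordinal (root_lt i)).
have f_inj : injective f.
  move=> i j fij; apply/val_inj/succn_inj.
  have eq_bits : bits i.+1 = bits j.+1 := congr1 fst fij.
  have eq_root : (root i.+1).-1 = (root j.+1).-1 := congr1 (fun x => val x.2) fij.
  have ri := root_le i.+1 (ltn_ord i); have rj := root_le j.+1 (ltn_ord j).
  rewrite (decomp i.+1 (ltn_ord i)) (decomp j.+1 (ltn_ord j)) !bitsE.
  by rewrite eq_bits; congr (_ ^ 2 * _); lia.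
have := leq_card f f_inj.
by rewrite card_prod card_tuple card_bool !card_ord /n leq_pmul2r.
Qed.

(** With k prime factors, the last condition keeps log n below 2 k^2, every fixed
    power of which is eventually smaller than the number 2^k of divisors. *)
Definition divisor_rich n := exists ps : seq nat,
  [/\ uniq (2 :: ps), all prime ps, 0 < size ps, n = prime_product (2 :: ps)
    & n <= 4 ^ ((size ps).+1 ^ 2)].

(** The product n of all the primes up to M^2 has k >= log_2 M factors by
    [prime_count_ge], hence n >= 2^k >= M and n <= (M^2)^k <= 4^(k^2). *)
Lemma divisor_rich_unbounded B : exists2 n, divisor_rich n & B < n.
Proof.
pose M := B.+3; have := prime_count_ge M; set n := M * M => M_le.
have [m nE] : exists m, n = m.+3 by exists (n - 3); rewrite /n /M; lia.
pose ps := [seq p <- iota 3 m.+1 | prime p].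
have psE : primes_upto n = 2 :: ps by rewrite nE.
have ps_uniq : uniq (2 :: ps) by rewrite -psE filter_uniq ?iota_uniq.
have ps_prime : all prime (2 :: ps) by rewrite -psE primes_upto_prime.
rewrite psE in M_le.
have prod_le : prime_product (2 :: ps) <= n ^ size (2 :: ps).
  have : all (fun p => p <= n) (2 :: ps).
    by rewrite -psE; apply/allP => p; rewrite mem_filter mem_iota => /and3P [_ _].
  rewrite /prime_product; elim: (2 :: ps) => [|p s IHs]; first by rewrite big_nil.
  by move=> /andP [p_le /IHs ?]; rewrite big_cons expnS leq_mul.
exists (prime_product (2 :: ps)).
  exists ps; split=> //; last first.
    apply: leq_trans prod_le _; rewrite -mulnn expnM leq_exp2r //.
    by rewrite -[4]/(2 * 2) expnMn leq_mul.
apply: leq_trans (prime_product_ge ps_prime); apply: leq_trans M_le.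
by rewrite /M; lia.
Qed.

(** With N = n/2 and k+1 prime factors, E(n) >= 2 gcd_sum(N) - n, which is at least
    n ((3/2)^k - 1). *)
Lemma divisor_rich_count n : divisor_rich n -> exists k, [/\ n <= 4 ^ (k ^ 2),
  2 ^ k <= size (divisors n) & n * k ^ 2 <= 16 * total_count n].
Proof.
move=> [ps [ps_uniq ps_prime ps_ne nE n_le]]; exists (size ps).+1; split=> //.
  by rewrite nE; apply: (@divisors_product (2 :: ps)).
have := gcd_sum_product (andP ps_uniq).2 ps_prime.
have := exp3_ge ps_ne.
have := prime_product_gt0 ps_prime.
rewrite nE prime_product_cons; move: (prime_product ps) (size ps) => N k N_gt0 exp_ge gcd_ge.
have count_ge : 2 * gcd_sum N <= total_count (2 * N) + 2 * N.
  rewrite [2 * N]mulnC total_count_even // big_split /= -big_distrr /= gcd_sumE //.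
  by move: (\sum_(s < N | 0 < s) gcdn N s) (\sum_(s < N | 0 < s) 1) => a b; lia.
have pow_gt0 : 0 < 2 ^ k by rewrite expn_gt0.
rewrite -(leq_pmul2r pow_gt0).
move: (2 ^ k) (3 ^ k) (total_count _) (gcd_sum N) exp_ge gcd_ge count_ge pow_gt0 => a b t g; nia.
Qed.

End HighlyComposite.

(** * The theorem *)

Lemma unbounded_infinite (S : set nat) :
  (forall B : nat, exists2 n, S n & (B < n)%N) -> infinite_set S.
Proof.
move=> unb /finite_fsetP [A SA].
have [n Sn] := unb (\sum_(x <- A) x)%N.
have nA : n \in A by have : [set` A] n by rewrite -SA.
by rewrite (big_rem n) //= ltnNge leq_addr.
Qed.

Lemma ln_le_of_exponent (R : realType) (n k : nat) : (0 < n)%N ->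
  (n <= 4 ^ (k ^ 2))%N -> ln (n%:R : R) <= (2 * k ^ 2)%:R.
Proof.
move=> n_gt0 n_le.
have n_pos : 0 < n%:R :> R by rewrite ltr0n.
have pow_pos : 0 < (2 : R) ^+ (2 * k ^ 2) by rewrite exprn_gt0.
apply: (@le_trans _ _ (ln ((2 : R) ^+ (2 * k ^ 2)))).
  by rewrite ler_ln ?posrE // exprM -!natrX ler_nat.
rewrite lnXn // -[X in X <= _]mulr_natl ler_piMr ?ler0n //.
by have := @le_ln1Dx R 1; apply; lra.
Qed.

Lemma square_free_divisor_rich n : divisor_rich n -> (3 <= n)%N /\ square_free n.
Proof.
move=> [ps [ps_uniq ps_prime ps_ne -> _]]; split; last first.
  by move=> d; apply: product_square_free.
apply: leq_trans (prime_product_ge (_ : all prime (2 :: ps)%N)) => //.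
by case: ps ps_ne {ps_uniq ps_prime} => // p ps _; rewrite /= !expnS; have := expn_gt0 2 (size ps); lia.
Qed.

Lemma divisor_rich_highly_composite (R : realType) :
  highly_composite_family R [set n | divisor_rich n].
Proof.
move=> j; have [K K_le] := poly_le_exp j.
exists (4 ^ (K ^ 2)).+1 => // n /= n_gt rich.
have [k [n_le div_ge _]] := divisor_rich_count rich.
have K_le_k : (K <= k)%N.
  rewrite leqNgt; apply/negP => k_lt.
  suff : (4 ^ (k ^ 2) <= 4 ^ (K ^ 2))%N by lia.
  by rewrite leq_exp2l // leq_exp2r // ltnW.
have n_gt0 : (0 < n)%N by lia.
apply: (@le_trans _ _ ((2 * k ^ 2)%:R ^+ j)).
  rewrite lerXn2r ?nnegrE ?ln_ge0 ?ler1n ?ler0n //.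
  exact: ln_le_of_exponent.
by rewrite -natrX ler_nat; apply: leq_trans div_ge; apply: K_le.
Qed.

(** Combine n k^2 <= 16 E(n) with ln n <= 2 k^2. *)
Lemma divisor_rich_count_ge (R : realType) n : divisor_rich n ->
  32^-1 * (n%:R * ln (n%:R : R)) <= (E R n)%:R.
Proof.
move=> rich; have [n_ge3 _] := square_free_divisor_rich rich.
have n_gt0 : (0 < n)%N by lia.
have [k [n_le _ count_ge]] := divisor_rich_count rich.
rewrite E_total_count // ler_pdivrMl //.
apply: (@le_trans _ _ (n%:R * (2 * k ^ 2)%:R)).
  by rewrite ler_wpM2l ?ler0n // ln_le_of_exponent.
by rewrite -natrM -[32]/(32%:R) -natrM ler_nat; lia.
Qed.

Theorem theorem1p8 (R : realType) :
  (forall n : nat, (3 <= n)%N ->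
     ((3 * n - 5) %/ 2 <= E R n)%N /\
     (E R n = ((3 * n - 5) %/ 2)%N <->
      exists p : nat, prime p /\ (n = p \/ n = (2 * p)%N))) /\
  (exists S : set nat,
     [/\ infinite_set S,
         forall n : nat, S n -> (3 <= n)%N /\ square_free n,
         highly_composite_family R S
       & exists c : R, 0 < c /\
           \forall n \near \oo, S n ->
             c * (n%:R * ln (n%:R : R)) <= (E R n)%:R]).
Proof.
split=> [n n_ge3|].
  rewrite E_total_count; last by lia.
  have [count_ge count_eq] := total_count_bound n_ge3.
  split=> //; split=> [/esym/eqP|[p [p_prime n_eq]]].
    rewrite count_eq => /orP [n_prime|/andP [even_n half_prime]].
      by exists n; split=> //; left.
    by exists n./2; split=> //; right; lia.
  apply/esym/eqP; rewrite count_eq; case: n_eq => [->|n_eq]; first by rewrite p_prime.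
  have -> : n./2 = p by lia.
  by rewrite p_prime n_eq mul2n odd_double orbT.
exists [set n | divisor_rich n]; split.
- exact: unbounded_infinite divisor_rich_unbounded.
- by move=> n /square_free_divisor_rich.
- exact: divisor_rich_highly_composite.
- exists 32^-1; split; first by rewrite invr_gt0.
  by exists 0%N => // n _; apply: divisor_rich_count_ge.
Qed.
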